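(* Let $K$ be a $\mathfrak{g}$-closed $\mathfrak{g}$-field, let $C=K^{\mathfrak{g}}$, and let $K^{\mathrm{nc}}$ be the normal closure of the field extension $C\subseteq K$. Then the restriction map $\mathrm{Gal}(C)\to\mathrm{Gal}(K^{\mathrm{nc}}/C)$ is a Frattini cover.
   Context: Let $\mathbf{k}$ be a field and $\mathfrak{g}=\mathrm{Spec}(H)$ a finite group scheme over $\mathbf{k}$ ($H$ a finite-dimensional commutative Hopf algebra with comultiplication $\mu$, counit $\pi$). A $\mathfrak{g}$-field is a field $K\supseteq\mathbf{k}$ with a $\mathbf{k}$-algebra map $\partial:K\to K\otimes_{\mathbf{k}}H$ satisfying $(\mathrm{id}\otimes\pi)\circ\partial=\mathrm{id}$ and $(\mathrm{id}\otimes\mu)\circ\partial=(\partial\otimes\mathrm{id})\circ\partial$; $K^{\mathfrak{g}}=\{x\in K:\partial(x)=x\otimes1\}$ (the extension $K^{\mathfrak{g}}\subseteq K$ is finite). A $\mathfrak{g}$-field $K$ is $\mathfrak{g}$-closed if there is no non-trivial $\mathfrak{g}$-field extension $K\subset L$ with $L$ algebraic over $K$. $\mathrm{Gal}(C)=\mathrm{Gal}(C^{\mathrm{sep}}/C)$ is the absolute Galois group, and $\mathrm{Gal}(K^{\mathrm{nc}}/C)$ is the group of $C$-automorphisms of $K^{\mathrm{nc}}$. An epimorphism of profinite groups $\alpha:A\to B$ is a Frattini cover if no proper closed subgroup of $A$ is mapped onto $B$. *)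

(* Defs.v *)
From HB Require Import structures.
From mathcomp Require Import all_boot all_order all_algebra all_field.
From mathcomp Require Import all_classical.
From mathcomp Require Import topology.

Set Implicit Arguments.
Unset Strict Implicit.
Unset Printing Implicit Defensive.

Import GRing.Theory.

Local Open Scope ring_scope.
Local Open Scope classical_set_scope.

(* Tensor products [A ⊗_k H] with [H] of finite dimension over the field [k]: *)
(* an element is written uniquely as [\sum_i a_i ⊗ e_i] with [e] the library's *)
(* basis [vbasis {:H}] of [H], and is encoded by its coefficients [a_i].      *)
Record tensor (k : fieldType) (A : lmodType k) (H : vectType k) : Type :=
  Tensor { tcoefs : {ffun 'I_(\dim {:H}) -> A} }.

HB.instance Definition _ (k : fieldType) (A : lmodType k) (H : vectType k) :=
  [isNew for @tcoefs k A H].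
HB.instance Definition _ (k : fieldType) (A : lmodType k) (H : vectType k) :=
  [Choice of tensor A H by <:].

Section TensorModule.
Variables (k : fieldType) (A : lmodType k) (H : vectType k).
Local Notation T := (tensor A H).
Local Notation e := (vbasis {:H}).

Definition tcoef (u : T) i : A := tcoefs u i.

Let tadd (u v : T) : T := Tensor (tcoefs u + tcoefs v).
Let topp (u : T) : T := Tensor (- tcoefs u).
Let tscale (c : k) (u : T) : T := Tensor (c *: tcoefs u).

Let taddA : associative tadd.
Proof. by move=> u v w; apply/val_inj/addrA. Qed.
Let taddC : commutative tadd.
Proof. by move=> u v; apply/val_inj/addrC. Qed.
Let tadd0 : left_id (Tensor 0) tadd.
Proof. by move=> u; apply/val_inj/add0r. Qed.
Let taddN : left_inverse (Tensor 0) topp tadd.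
Proof. by move=> u; apply/val_inj/addNr. Qed.

HB.instance Definition _ := GRing.isZmodule.Build T taddA taddC tadd0 taddN.

Let tscaleA a b (u : T) : tscale a (tscale b u) = tscale (a * b) u.
Proof. exact/val_inj/scalerA. Qed.
Let tscale1 : left_id 1 tscale.
Proof. by move=> u; apply/val_inj/scale1r. Qed.
Let tscaleDr : right_distributive tscale +%R.
Proof. by move=> c u v; apply/val_inj/scalerDr. Qed.
Let tscaleDl (u : T) : {morph tscale^~ u : a b / a + b}.
Proof. by move=> a b; apply/val_inj/scalerDl. Qed.

HB.instance Definition _ :=
  GRing.Zmodule_isLmodule.Build k T tscaleA tscale1 tscaleDr tscaleDl.

Definition pure (a : A) (h : H) : T := Tensor [ffun i => coord e i h *: a].

(* For [b] bilinear, the linear map induced by [b] on the tensor product:     *)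
(* see [tliftE] and [tensorE].                                                *)
Definition tlift (V : nmodType) (b : A -> H -> V) (u : T) : V :=
  \sum_i b (tcoef u i) e`_i.

Lemma tensorP (u v : T) : tcoef u =1 tcoef v -> u = v.
Proof. by move=> uv; apply/val_inj/ffunP. Qed.

Lemma tcoef0 i : tcoef 0 i = 0.
Proof. by rewrite /tcoef ffunE. Qed.

Lemma tcoefD u v i : tcoef (u + v) i = tcoef u i + tcoef v i.
Proof. by rewrite /tcoef ffunE. Qed.

Lemma tcoefZ (c : k) u i : tcoef (c *: u) i = c *: tcoef u i.
Proof. by rewrite /tcoef ffunE. Qed.

Lemma tcoef_pure a h i : tcoef (pure a h) i = coord e i h *: a.
Proof. by rewrite /tcoef ffunE. Qed.

Lemma tcoef_sum I r (P : pred I) (F : I -> T) i :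
  tcoef (\sum_(j <- r | P j) F j) i = \sum_(j <- r | P j) tcoef (F j) i.
Proof.
by elim/big_rec2: _ => [|j x y _ <-]; [rewrite tcoef0 | rewrite tcoefD].
Qed.

Lemma pureDl a b h : pure (a + b) h = pure a h + pure b h.
Proof. by apply: tensorP => i; rewrite tcoefD !tcoef_pure scalerDr. Qed.

Lemma pureDr a g h : pure a (g + h) = pure a g + pure a h.
Proof. by apply: tensorP => i; rewrite tcoefD !tcoef_pure linearD scalerDl. Qed.

Lemma pureZl c a h : pure (c *: a) h = c *: pure a h.
Proof.
by apply: tensorP => i; rewrite tcoefZ !tcoef_pure !scalerA mulrC.
Qed.

Lemma pureZr c a h : pure a (c *: h) = c *: pure a h.
Proof. by apply: tensorP => i; rewrite tcoefZ !tcoef_pure linearZ scalerA. Qed.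

Lemma pure_sumr a I r (P : pred I) (F : I -> H) :
  pure a (\sum_(j <- r | P j) F j) = \sum_(j <- r | P j) pure a (F j).
Proof.
elim/big_rec2: _ => [|j x y _ <-]; last by rewrite pureDr.
by rewrite -[X in pure a X](scale0r 0) pureZr scale0r.
Qed.

Lemma tensorE u : u = tlift pure u.
Proof.
apply: tensorP => i; rewrite tcoef_sum (bigD1 i) //= big1 => [|j ji].
  rewrite tcoef_pure coord_free ?(basis_free (vbasisP _)) //.
  by rewrite eqxx scale1r addr0.
rewrite tcoef_pure coord_free ?(basis_free (vbasisP _)) //.
by rewrite (negPf ji) scale0r.
Qed.

Lemma tlift_is_linear (V : lmodType k) (b : A -> H -> V) :
    (forall h, linear (b^~ h)) ->
  linear (tlift b).
Proof.
move=> bl c u v; rewrite /tlift scaler_sumr -big_split /=.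
by apply: eq_bigr => i _; rewrite tcoefD tcoefZ bl.
Qed.

Lemma tliftE (V : lmodType k) (b : A -> H -> V) a h :
    (forall h, linear (b^~ h)) -> (forall a, linear (b a)) ->
  tlift b (pure a h) = b a h.
Proof.
move=> bl br; rewrite {2}(coord_vbasis (memvf h)) /tlift.
have [b0 bD bZ] : [/\ b a 0 = 0, {morph b a : x y / x + y}
                    & forall c, {morph b a : x / c *: x}].
  have b0 : b a 0 = 0.
    have := br a (-1) 0 0; rewrite scaler0 addr0 scaleN1r => E.
    by rewrite E addNr.
  by split=> // [x y|c x]; [have := br a 1 x y|have := br a c x 0];
    rewrite ?scale1r // b0 !addr0.
rewrite (big_morph (b a) bD b0); apply: eq_bigr => i _.
rewrite tcoef_pure bZ.
have := bl e`_i (coord e i h) a 0; rewrite addr0 => ->.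
have := bl e`_i (-1) 0 0; rewrite scaler0 addr0 scaleN1r addNr => ->.
by rewrite addr0.
Qed.

End TensorModule.

Section TensorAlgebra.
Variables (k : fieldType) (A : algType k) (H : falgType k).
Local Notation T := (tensor A H).

Definition tensor_one : T := pure 1 1.

Definition tensor_mul (u v : T) : T :=
  tlift (fun a g => tlift (fun b h => pure (a * b) (g * h)) v) u.

Let inner_linear a g : linear (tlift (fun b h => pure (a * b) (g * h)) : T -> T).
Proof.
apply: tlift_is_linear => h c x y.
by rewrite mulrDr -scalerAr pureDl pureZl.
Qed.

Let tmul_lin_l v : linear (tensor_mul^~ v).
Proof.
apply: tlift_is_linear => g c x y; rewrite /tlift scaler_sumr -big_split /=.
by apply: eq_bigr => i _; rewrite mulrDl -scalerAl pureDl pureZl.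
Qed.

Let tmul_lin_r u : linear (tensor_mul u).
Proof.
move=> c v w; rewrite /tensor_mul /tlift scaler_sumr -big_split /=.
by apply: eq_bigr => i _; rewrite -inner_linear.
Qed.

Lemma tensor_mul_pure a g b h :
  tensor_mul (pure a g) (pure b h) = pure (a * b) (g * h).
Proof.
rewrite /tensor_mul tliftE.
- rewrite tliftE // => [h' c x y|a' c x y].
    by rewrite mulrDr -scalerAr pureDl pureZl.
  by rewrite mulrDr -scalerAr pureDr pureZr.
- move=> h' c x y; rewrite /tlift scaler_sumr -big_split /=.
  by apply: eq_bigr => i _; rewrite mulrDl -scalerAl pureDl pureZl.
- move=> h' c x y; rewrite /tlift scaler_sumr -big_split /=.
  by apply: eq_bigr => i _; rewrite mulrDl -scalerAl pureDr pureZr.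
Qed.

Let lin_add (f : T -> T) : linear f -> {morph f : x y / x + y}.
Proof. by move=> fl x y; have := fl 1 x y; rewrite !scale1r. Qed.

Let lin_zero (f : T -> T) : linear f -> f 0 = 0.
Proof.
by move=> fl; have := fl (-1) 0 0; rewrite scaler0 addr0 scaleN1r addNr.
Qed.

(* Two linear endomaps agreeing on pure tensors are equal.                    *)
Let lin_ext (f g : T -> T) : linear f -> linear g ->
  (forall a h, f (pure a h) = g (pure a h)) -> f =1 g.
Proof.
move=> fl gl fg u; rewrite (tensorE u) /tlift.
rewrite (big_morph f (lin_add fl) (lin_zero fl)).
rewrite (big_morph g (lin_add gl) (lin_zero gl)).
by apply: eq_bigr.
Qed.

Let tmulA : associative tensor_mul.
Proof.
move=> u v w; move: u; apply: lin_ext => [||a g].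
- exact: tmul_lin_l.
- by move=> c x y; rewrite !tmul_lin_l.
move: v; apply: lin_ext => [||b h].
- by move=> c x y; rewrite tmul_lin_l tmul_lin_r.
- by move=> c x y; rewrite tmul_lin_r tmul_lin_l.
move: w; apply: lin_ext => [||c l].
- by move=> c x y; rewrite !tmul_lin_r.
- by move=> c x y; rewrite !tmul_lin_r.
by rewrite !tensor_mul_pure !mulrA.
Qed.

Let tmul1r : left_id tensor_one tensor_mul.
Proof.
apply: lin_ext => [c x y|//|a h]; first by rewrite tmul_lin_r.
by rewrite tensor_mul_pure !mul1r.
Qed.

Let tmulr1 : right_id tensor_one tensor_mul.
Proof.
apply: lin_ext => [c x y|//|a h]; first by rewrite tmul_lin_l.
by rewrite tensor_mul_pure !mulr1.
Qed.

Let tmulDl : left_distributive tensor_mul +%R.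
Proof. by move=> u v w; rewrite (lin_add (tmul_lin_l w)). Qed.

Let tmulDr : right_distributive tensor_mul +%R.
Proof. by move=> u v w; rewrite (lin_add (tmul_lin_r u)). Qed.

Let tone_neq0 : tensor_one != 0.
Proof.
apply/eqP => E0; have /eqP := oner_neq0 H; apply.
rewrite (coord_vbasis (memvf (1 : H))) big1 // => i _.
have := congr1 (fun u => tcoef u i) E0; rewrite tcoef_pure tcoef0.
by move/eqP; rewrite scaler_eq0 oner_eq0 orbF => /eqP ->; rewrite scale0r.
Qed.

HB.instance Definition _ := GRing.Zmodule_isNzRing.Build T
  tmulA tmul1r tmulr1 tmulDl tmulDr tone_neq0.

Let tscalerAl (c : k) (u v : T) : c *: (u * v) = (c *: u) * v.
Proof. by have := tmul_lin_l v c u 0; rewrite addr0 (lin_zero (tmul_lin_l v)) addr0. Qed.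

HB.instance Definition _ := GRing.Lmodule_isLalgebra.Build k T tscalerAl.

Let tscalerAr (c : k) (u v : T) : c *: (u * v) = u * (c *: v).
Proof. by have := tmul_lin_r u c v 0; rewrite addr0 (lin_zero (tmul_lin_r u)) addr0. Qed.

HB.instance Definition _ := GRing.Lalgebra_isAlgebra.Build k T tscalerAr.

End TensorAlgebra.

Record hopf_algebra (k : fieldType) := HopfAlgebra {
  hopf_sort :> falgType k;
  hopf_mulC : commutative (@GRing.mul hopf_sort);
  comul : {lrmorphism hopf_sort -> tensor hopf_sort hopf_sort};
  counit : {lrmorphism hopf_sort -> k^o};
  antipode : {linear hopf_sort -> hopf_sort};
  comulA : forall h : hopf_sort,
    tlift (fun g l => tlift (fun l1 l2 => pure (pure g l1) l2) (comul l))
      (comul h)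
    = tlift (fun g l => pure (comul g) l) (comul h);
  comul_counitl : forall h : hopf_sort,
    tlift (fun g l => counit g *: l) (comul h) = h;
  comul_counitr : forall h : hopf_sort,
    tlift (fun g l => counit l *: g) (comul h) = h;
  antipodel : forall h : hopf_sort,
    tlift (fun g l => antipode g * l) (comul h) = (counit h)%:A;
  antipoder : forall h : hopf_sort,
    tlift (fun g l => g * antipode l) (comul h) = (counit h)%:A
}.

(* The field [K], seen as an algebra over [k] through [i].                    *)
Definition algebra_of (k K : fieldType) (i : {rmorphism k -> K}) : Type := K.

Section AlgebraOf.
Variables (k K : fieldType) (i : {rmorphism k -> K}).
Local Notation Ki := (algebra_of i).

HB.instance Definition _ := GRing.Field.copy Ki K.

Let scale (c : k) (x : Ki) : Ki := i c * x.

Let scaleA a b x : scale a (scale b x) = scale (a * b) x.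
Proof. by rewrite /scale mulrA rmorphM. Qed.
Let scale1 : left_id 1 scale.
Proof. by move=> x; rewrite /scale rmorph1 mul1r. Qed.
Let scaleDr : right_distributive scale +%R.
Proof. by move=> c x y; rewrite /scale mulrDr. Qed.
Let scaleDl x : {morph scale^~ x : a b / a + b}.
Proof. by move=> a b; rewrite /scale rmorphD mulrDl. Qed.

HB.instance Definition _ :=
  GRing.Zmodule_isLmodule.Build k Ki scaleA scale1 scaleDr scaleDl.

Let scaleAl (c : k) (x y : Ki) : c *: (x * y) = (c *: x) * y.
Proof. exact: mulrA. Qed.

HB.instance Definition _ := GRing.Lmodule_isLalgebra.Build k Ki scaleAl.

Let scaleAr (c : k) (x y : Ki) : c *: (x * y) = x * (c *: y).
Proof. exact: mulrCA. Qed.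

HB.instance Definition _ := GRing.Lalgebra_isAlgebra.Build k Ki scaleAr.

End AlgebraOf.

Record gfield (k : fieldType) (H : hopf_algebra k) := GField {
  gfield_sort :> fieldType;
  gfield_in : {rmorphism k -> gfield_sort};
  coact : {lrmorphism algebra_of gfield_in -> tensor (algebra_of gfield_in) H};
  coact_counit : forall x : algebra_of gfield_in,
    tlift (fun y h => counit H h *: y) (coact x) = x;
  coactA : forall x : algebra_of gfield_in,
    tlift (fun y h => tlift (fun h1 h2 => pure (pure y h1) h2) (comul H h))
      (coact x)
    = tlift (fun y h => pure (coact y) h) (coact x)
}.

Section GFields.
Variables (k : fieldType) (H : hopf_algebra k).

Definition invariants (K : gfield H) : {pred K} :=
  [pred x : K | coact K x == pure (x : algebra_of (gfield_in K)) 1].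
Arguments invariants : clear implicits.

Definition gfield_ext (K L : gfield H) (f : {rmorphism K -> L}) : Prop :=
  (forall c : k, f (gfield_in K c) = gfield_in L c) /\
  (forall x : K, coact L (f x)
     = tlift (fun (y : algebra_of (gfield_in K)) h =>
                pure (f y : algebra_of (gfield_in L)) h) (coact K x)).

Definition gclosed (K : gfield H) : Prop :=
  forall (L : gfield H) (f : {rmorphism K -> L}),
  gfield_ext f -> (forall y : L, algebraicOver f y) ->
  forall y : L, exists x : K, f x = y.

Lemma invariants_divring_closed (K : gfield H) : divring_closed (invariants K).
Proof.
pose i := gfield_in K; pose d := coact K.
have invP (x : algebra_of i) : reflect (d x = pure x 1) (x \in invariants K).
  exact: eqP.
have invV (x : algebra_of i) : d x = pure x 1 -> d x^-1 = pure x^-1 1.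
  have [->|x0] := eqVneq x 0; first by rewrite invr0.
  move=> dx; have vx : pure x^-1 1 * pure x 1 = 1 :> tensor (algebra_of i) H.
    by rewrite [LHS]tensor_mul_pure mulVf // mulr1.
  have dvx : d x * d x^-1 = 1 by rewrite -rmorphM mulfV // rmorph1.
  by rewrite -[LHS]mul1r -vx -mulrA -dx dvx mulr1.
split=> [|x y /invP dx /invP dy|x y /invP dx /invP dy]; apply/invP.
- by rewrite [LHS]rmorph1.
- have -> : d (x - y) = d x - d y by exact: rmorphB.
  by rewrite dx dy; apply/eqP; rewrite subr_eq -pureDl subrK.
- have -> : d (x / y) = d x * d y^-1 by exact: rmorphM.
  by rewrite dx (invV _ dy) [LHS]tensor_mul_pure mulr1.
Qed.

HB.instance Definition _ (K : gfield H) :=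
  GRing.isDivringClosed.Build K (invariants K) (invariants_divring_closed K).

Definition invariant_field (K : gfield H) : Type := {x : K | x \in invariants K}.

HB.instance Definition _ (K : gfield H) := SubChoice.on (invariant_field K).
HB.instance Definition _ (K : gfield H) :=
  [SubChoice_isSubIntegralDomain of invariant_field K by <:].
HB.instance Definition _ (K : gfield H) :=
  [SubIntegralDomain_isSubField of invariant_field K by <:].

End GFields.

Section Subfields.
Variable L : fieldType.

Definition least_subfield (P : {pred L} -> Prop) : {pred L} :=
  [pred x | `[< forall E : {pred L}, divring_closed E -> P E -> x \in E >]].

Lemma least_subfield_divring_closed P : divring_closed (least_subfield P).
Proof.
split=> [|x y /asboolP lx /asboolP ly|x y /asboolP lx /asboolP ly];
  apply/asboolP => E dE PE; have [E1 EB EV] := dE; first exact: E1.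
  by apply: EB; [apply: lx|apply: ly].
by apply: EV; [apply: lx|apply: ly].
Qed.

HB.instance Definition _ P :=
  GRing.isDivringClosed.Build L (least_subfield P)
    (least_subfield_divring_closed P).

Definition least_field (P : {pred L} -> Prop) : Type :=
  {x : L | x \in least_subfield P}.

HB.instance Definition _ P := SubChoice.on (least_field P).
HB.instance Definition _ P :=
  [SubChoice_isSubIntegralDomain of least_field P by <:].
HB.instance Definition _ P :=
  [SubIntegralDomain_isSubField of least_field P by <:].

End Subfields.

(* The group of automorphisms of [E] fixing [B] pointwise, with the Krull     *)
(* topology: the automorphisms that agree with [s] on a given finite subset   *)
(* of [E] form a basic neighbourhood of [s].                                  *)
Record gal (E : fieldType) (B : set E) := Gal {
  gal_fun :> E -> E;
  gal_add : {morph gal_fun : x y / x + y};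
  gal_mul : {morph gal_fun : x y / x * y};
  gal_one : gal_fun 1 = 1;
  gal_bij : bijective gal_fun;
  gal_fix : forall x, B x -> gal_fun x = x
}.

HB.instance Definition _ E B := gen_eqMixin (@gal E B).
HB.instance Definition _ E B := gen_choiceMixin (@gal E B).

Section GaloisGroup.
Variables (E : fieldType) (B : set E).
Local Notation G := (gal B).

Lemma galP (s t : G) : s =1 t -> s = t.
Proof.
case: s t => [s ? ? ? ? ?] [t ? ? ? ? ?] /= /funext st.
by subst t; congr Gal; apply: Prop_irrelevance.
Qed.

Definition gal_id : G :=
  @Gal E B idfun (fun _ _ => erefl) (fun _ _ => erefl) erefl
    (Bijective (fun _ => erefl) (fun _ => erefl)) (fun _ _ => erefl).

Section Comp.
Variables s t : G.
Let compD : {morph s \o t : x y / x + y}.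
Proof. by move=> x y /=; rewrite !gal_add. Qed.
Let compM : {morph s \o t : x y / x * y}.
Proof. by move=> x y /=; rewrite !gal_mul. Qed.
Let comp1 : (s \o t) 1 = 1.
Proof. by rewrite /= !gal_one. Qed.
Let comp_fix x : B x -> (s \o t) x = x.
Proof. by move=> Bx /=; rewrite !gal_fix. Qed.

Definition gal_comp : G :=
  Gal compD compM comp1 (bij_comp (gal_bij s) (gal_bij t)) comp_fix.
End Comp.

Section Inverse.
Variable s : G.
Let preim y : {x | s x = y}.
Proof. by apply: cid; case: (gal_bij s) => g _ gK; exists (g y). Qed.
Let inv y := sval (preim y).
Let invK y : s (inv y) = y. Proof. exact: (svalP (preim y)). Qed.
Let inj : injective s. Proof. exact: bij_inj (gal_bij s). Qed.
Let invD : {morph inv : x y / x + y}.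
Proof. by move=> x y; apply: inj; rewrite gal_add !invK. Qed.
Let invM : {morph inv : x y / x * y}.
Proof. by move=> x y; apply: inj; rewrite gal_mul !invK. Qed.
Let inv1 : inv 1 = 1.
Proof. by apply: inj; rewrite gal_one invK. Qed.
Let inv_bij : bijective inv.
Proof. by exists s => [|x]; [exact: invK|apply: inj; rewrite invK]. Qed.
Let inv_fix x : B x -> inv x = x.
Proof. by move=> Bx; apply: inj; rewrite invK gal_fix. Qed.

Definition gal_inv : G := Gal invD invM inv1 inv_bij inv_fix.

Lemma gal_invK x : s (gal_inv x) = x.
Proof. exact: invK. Qed.
End Inverse.

Let gal_mulA : associative gal_comp. Proof. by move=> s t u; exact: galP. Qed.
Let gal_mul1 : left_id gal_id gal_comp. Proof. by move=> s; exact: galP. Qed.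
Let gal_1mul : right_id gal_id gal_comp. Proof. by move=> s; exact: galP. Qed.
Let gal_mulV : right_inverse gal_id gal_inv gal_comp.
Proof. by move=> s; apply: galP => x; exact: gal_invK. Qed.
Let gal_Vmul : left_inverse gal_id gal_inv gal_comp.
Proof.
move=> s; apply: galP => x; apply: (bij_inj (gal_bij s)).
exact: gal_invK.
Qed.

HB.instance Definition _ := isGroup.Build G
  gal_mulA gal_mul1 gal_1mul gal_Vmul gal_mulV.

Definition krull_nbhs (s : G) : set_system G :=
  [set U | exists X : seq E, forall t : G, {in X, t =1 s} -> U t].

HB.instance Definition _ := hasNbhs.Build G krull_nbhs.

Let krull_filter (s : G) : ProperFilter (nbhs s).
Proof.
split; first by case=> X /(_ s); apply.
split; first by exists [::].
- move=> U V [X XU] [Y YV]; exists (X ++ Y) => t ts.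
  by split; [apply: XU|apply: YV] => x xX; apply: ts; rewrite mem_cat xX ?orbT.
- by move=> U V UV [X XU]; exists X => t /XU /UV.
Qed.

Let krull_singleton (s : G) (U : set G) : nbhs s U -> U s.
Proof. by case=> X; apply. Qed.

Let krull_nbhs_nbhs (s : G) (U : set G) : nbhs s U -> nbhs s (nbhs^~ U).
Proof.
case=> X XU; exists X => t ts; exists X => u ut; apply: XU => x xX.
by rewrite ut // ts.
Qed.

HB.instance Definition _ := Nbhs_isNbhsTopological.Build G
  krull_filter krull_singleton krull_nbhs_nbhs.

End GaloisGroup.

HB.mixin Record isTopGroup G of Group G & Topological G := {
  mulg_continuous : continuous (fun xy : G * G => (xy.1 * xy.2)%g);
  invg_continuous : continuous (fun x : G => x^-1%g)
}.

#[short(type="topGroupType")]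
HB.structure Definition TopGroup := {G of isTopGroup G & Group G & Topological G}.

Section GaloisTopGroup.
Variables (E : fieldType) (B : set E).
Local Notation G := (gal B).

Let gal_mul_continuous : continuous (fun st : G * G => (st.1 * st.2)%g).
Proof.
move=> [s t] U [X XU].
exists ([set s' : G | {in [seq t x | x <- X], s' =1 s}],
        [set t' : G | {in X, t' =1 t}]).
  by split; [exists [seq t x | x <- X]|exists X].
move=> [s' t'] [/= s's t't]; apply: XU => x xX.
by rewrite /= t't // s's // map_f.
Qed.

Let gal_inv_continuous : continuous (fun s : G => s^-1%g).
Proof.
move=> s U [X XU]; exists [seq gal_inv s x | x <- X] => t ts; apply: XU => x xX.
apply: (bij_inj (gal_bij t)); rewrite [LHS]gal_invK.
by rewrite [RHS]ts ?map_f // [RHS]gal_invK.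
Qed.

HB.instance Definition _ := isTopGroup.Build G
  gal_mul_continuous gal_inv_continuous.

End GaloisTopGroup.

Definition profinite (G : topGroupType) : Prop :=
  [/\ hausdorff_space G, compact [set: G] & totally_disconnected [set: G]].

Definition profinite_epi (G Q : topGroupType) (f : G -> Q) : Prop :=
  [/\ profinite G, profinite Q, {morph f : x y / (x * y)%g},
      continuous f & forall y, exists x, f x = y].

Definition frattini_cover (G Q : topGroupType) (f : G -> Q) : Prop :=
  profinite_epi f /\
  forall N : {pred G}, group_closed N -> closed [set` N] ->
    f @` [set` N] = [set: Q] -> [set` N] = [set: G].

(* All extensions of [F] live in [Omega], embedded by [i]; in the uses,       *)
(* [Omega] is an algebraic closure of [F].                                    *)
Section GaloisTheory.
Variables (F : fieldType) (Omega : closedFieldType) (i : {rmorphism F -> Omega}).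

Definition separable_over (w : Omega) : Prop :=
  exists p : {poly F}, separable_poly p /\ root (map_poly i p) w.

Definition contains_separable (E : {pred Omega}) : Prop :=
  forall w, separable_over w -> w \in E.

Definition sep_closure : Type := least_field contains_separable.

Definition normal_over (E : {pred Omega}) : Prop :=
  [/\ divring_closed E, forall c, i c \in E,
      forall w, w \in E -> algebraicOver i w
    & forall p : {poly F}, irreducible_poly p ->
      forall w, w \in E -> root (map_poly i p) w ->
      forall z, root (map_poly i p) z -> z \in E].

Definition normal_containing (K : fieldType) (j : {rmorphism K -> Omega})
    (E : {pred Omega}) : Prop :=
  normal_over E /\ forall x : K, j x \in E.

Definition normal_closure (K : fieldType) (j : {rmorphism K -> Omega}) : Type :=
  least_field (normal_containing j).

Definition Gal_over (P : {pred Omega} -> Prop) : Type :=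
  gal [set x : least_field P | range i (val x)].

HB.instance Definition _ P := TopGroup.on (Gal_over P).

Definition absGal : Type := Gal_over contains_separable.

HB.instance Definition _ := TopGroup.on absGal.

Definition normal_Gal (K : fieldType) (j : {rmorphism K -> Omega}) : Type :=
  Gal_over (normal_containing j).

HB.instance Definition _ (K : fieldType) (j : {rmorphism K -> Omega}) :=
  TopGroup.on (normal_Gal j).

(* The normal closure need not be separable over [F]: an automorphism of the  *)
(* separable closure is first extended to [Omega] (uniquely, since [Omega] is *)
(* purely inseparable over the separable closure), then restricted.           *)
Definition is_restriction (K : fieldType) (j : {rmorphism K -> Omega})
    (r : absGal -> normal_Gal j) : Prop :=
  forall s : absGal, exists t : gal (range i),
    (forall x : sep_closure, t (val x) = val (s x)) /\
    (forall x : normal_closure j, t (val x) = val (r s x)).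

End GaloisTheory.

Definition invariant_in (k : fieldType) (H : hopf_algebra k) (K : gfield H)
    (Omega : fieldType) (j : {rmorphism K -> Omega}) :
  {rmorphism invariant_field K -> Omega} := j \o val.

(* Main.v *)
Require Import Defs.
From HB Require Import structures.
From mathcomp Require Import all_boot all_order all_algebra all_field.
From mathcomp Require Import all_classical.
From mathcomp Require Import topology.
Import Defs.

Set Implicit Arguments.
Unset Strict Implicit.
Unset Printing Implicit Defensive.

Import GRing.Theory.

Local Open Scope ring_scope.
Local Open Scope classical_set_scope.

(* Every [x] in [K] is algebraic over [C = K^g]: the minimal polynomial over   *)
(* [K] of [∂ x] in [K ⊗ H] has coefficients in [C], and the counit makes [x] a *)
(* root. Hence [Omega] is algebraic over [C], and an automorphism of [C^sep]   *)
(* extends uniquely to [Omega], where it can be restricted to [K^nc].          *)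
(* For the Frattini property let [N] be closed and mapped onto [Gal(K^nc/C)],  *)
(* and let [x] in [C^sep] be fixed by [N]. Any automorphism over [C] agrees on *)
(* [K^nc] with an element of [N], so all [C]-conjugates of [x] are conjugate   *)
(* over [K]: the minimal polynomial of [x] over [K] has coefficients in [C].   *)
(* Then [∂] extends to [K(x)] by [∂ x = x ⊗ 1], and [K(x) = K] because [K] is  *)
(* g-closed, so that this polynomial is linear and [x] is in [C]. By Galois    *)
(* theory [N] is everything.                                                   *)

(** * Extension of field morphisms *)

(** All groups are compared through the automorphisms of [Omega] over C. By [extend_ex] and
    [restrict_ex] these restrict onto the group of every stable subfield containing C, and by
    [aut_eq_on_separable] they are determined on C^sep, over which [Omega] is purely inseparable.
    This gives the restriction map, its uniqueness and [restriction_epi]. It requires [Omega] to be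
    algebraic over C, which rests on [algebraic_over_invariants]: thanks to the antipode, a K-linear
    relation among the coordinate vectors of the ∂(x^l) stays a relation when its coefficients are
    replaced by their coordinates under ∂ ([coact_relation]), so the shortest monic relation has
    coefficients in C.

    For the Frattini property, an element x of C^sep fixed by N keeps its minimal polynomial when C
    is enlarged to K ([frattini_minpoly]). So K(x) is K ⊗_C C(x), a g-field with trivial coaction on
    the second factor ([gclosed_simple_extension]); g-closedness makes the degree 1, already over C
    ([gclosed_root]). The fixed field of N in C^sep is therefore C, and [closed_subgroup_full], the
    Galois correspondence for closed subgroups, concludes. *)

Lemma minpoly_ex (F : fieldType) (L : closedFieldType) (i : {rmorphism F -> L})
    (w : L) :
  algebraicOver i w ->
  exists m : {poly F}, [/\ m \is monic, irreducible_poly m &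
    forall q, root (map_poly i q) w = (m %| q)].
Proof.
move=> /integral_algebraic wi.
have dec : decidable_embedding i by move=> y; exact: pselect.
have [m [mm mw irr]] := minPoly_decidable_closure dec wi.
exists m; split=> // q; apply/idP/idP => [qw|mq]; last first.
  by apply: root_dvdp mw; rewrite dvdp_map.
apply: contraT => nmq.
have : coprimep (map_poly i m) (map_poly i q).
  by rewrite coprimep_map irreducible_poly_coprime.
by move/coprimep_root => /(_ _ mw); rewrite -/(root _ _) qw.
Qed.

(** Turns a division-closed predicate into an actual field with an embedding: [least_field] already
    carries the structure. *)
Lemma subfield_ex (L : fieldType) (S : {pred L}) : divring_closed S ->
  exists (D : fieldType) (a : {rmorphism D -> L}),
    forall x, x \in S <-> exists d, a d = x.
Proof.
move=> dS; pose P (E : {pred L}) := {subset S <= E}.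
exists (least_field P), val => x; split=> [xS|[d <-]].
  have xP : x \in least_subfield P by apply/asboolP => E _; apply.
  by exists (exist _ x xP).
by have /asboolP/(_ S dS) := valP d; apply.
Qed.

Lemma map_poly_lift (D L : fieldType) (a : {rmorphism D -> L}) (p : {poly L}) :
  (forall l, range a p`_l) -> exists q, map_poly a q = p.
Proof.
move=> ap; have /choice[g gP] l : exists d, a d = p`_l.
  by have [d _ ad] := ap l; exists d.
exists (\poly_(l < size p) g l); apply/polyP => l.
rewrite coef_map coef_poly; case: ltnP => [_|lp]; first exact: gP.
by rewrite [LHS](rmorph0 a) nth_default.
Qed.

Lemma rmorphism_lift (F D L : fieldType) (i : {rmorphism F -> L})
    (a : {rmorphism D -> L}) :
  range i `<=` range a -> exists f : {rmorphism F -> D}, forall c, a (f c) = i c.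
Proof.
move=> ia; have /choice[f fP] c : exists d, a d = i c.
  by have [|d _ ad] := ia (i c); [exists c|exists d].
have fB : zmod_morphism f.
  by move=> x y; apply: (fmorph_inj a); rewrite rmorphB !fP rmorphB.
have fM : monoid_morphism f.
  split=> [|x y]; apply: (fmorph_inj a); first by rewrite fP !rmorph1.
  by rewrite fP !rmorphM /= !fP.
pose f1 := GRing.isZmodMorphism.Build F D f fB.
pose f2 := GRing.isMonoidMorphism.Build F D f fM.
by exists (HB.pack f f1 f2 : {rmorphism F -> D}).
Qed.

Lemma algebraicOver_range (F D L : fieldType) (i : {rmorphism F -> L})
    (a : {rmorphism D -> L}) w :
  range i `<=` range a -> algebraicOver i w -> algebraicOver a w.
Proof.
move=> ia [p p0 pw]; have [f fP] := rmorphism_lift ia.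
exists (map_poly f p); first by rewrite map_poly_eq0.
by rewrite -map_poly_comp (eq_map_poly fP).
Qed.

Section Graphs.
Variables L M : fieldType.

(* A subfield of [L * M] that is the graph of a field morphism.               *)
Definition field_graph (G : set (L * M)) : Prop :=
  [/\ G (1, 1), forall u v, G u -> G v -> G (u.1 - v.1, u.2 - v.2),
      forall u v, G u -> G v -> G (u.1 / v.1, u.2 / v.2)
    & forall y, G (0, y) -> y = 0].

Definition graph (D : Type) (a : D -> L) (b : D -> M) : set (L * M) :=
  range (fun d => (a d, b d)).

Lemma graph_is_field_graph (D : fieldType) (a : {rmorphism D -> L})
    (b : {rmorphism D -> M}) : field_graph (graph a b).
Proof.
split=> [|u v [d _ <-] [e _ <-]|u v [d _ <-] [e _ <-]|y [d _ [ad <-]]].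
- by exists 1; rewrite ?rmorph1.
- by exists (d - e); rewrite ?rmorphB.
- by exists (d / e); rewrite ?fmorph_div.
- by move/eqP: ad; rewrite fmorph_eq0 => /eqP ->; rewrite rmorph0.
Qed.

Lemma field_graph_fun G x y y' : field_graph G -> G (x, y) -> G (x, y') -> y = y'.
Proof.
case=> _ GB _ G0 Gy Gy'; apply/subr0_eq/G0.
by have := GB _ _ Gy Gy'; rewrite /= subrr.
Qed.

(** The first projection of [G] is a subfield, and the condition on pairs (0, y) makes the second
    entry a function of the first. Partial morphisms thus become plain subsets, to which Zorn's
    lemma applies. *)
Lemma field_graph_ex G : field_graph G ->
  exists (D : fieldType) (a : {rmorphism D -> L}) (b : {rmorphism D -> M}),
    G = graph a b.
Proof.
move=> gG; have [G1 GB GV G0] := gG.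
pose S : {pred L} := [pred x | `[< exists y, G (x, y) >]].
have dS : divring_closed S.
  split=> [|x y /asboolP[z Gz] /asboolP[t Gt]|x y /asboolP[z Gz] /asboolP[t Gt]];
    apply/asboolP.
  - by exists 1.
  - by exists (z - t); exact: (GB _ _ Gz Gt).
  - by exists (z / t); exact: (GV _ _ Gz Gt).
have [D [a aP]] := subfield_ex dS.
have /choice[b bP] d : exists y, G (a d, y).
  by have /asboolP : a d \in S by apply/aP; exists d.
have bB : zmod_morphism b.
  move=> d e; apply: field_graph_fun gG (bP _) _; rewrite rmorphB.
  exact: (GB _ _ (bP d) (bP e)).
have b1 : b 1 = 1.
  by apply: field_graph_fun gG (bP _) _; rewrite rmorph1.
have bV d e : b (d / e) = b d / b e.
  apply: field_graph_fun gG (bP _) _; rewrite fmorph_div.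
  exact: (GV _ _ (bP d) (bP e)).
have bM : monoid_morphism b.
  split=> // d e; have -> : d * e = d / (1 / e) by rewrite div1r invrK.
  by rewrite !bV b1 div1r invrK.
pose bA := GRing.isZmodMorphism.Build D M b bB.
pose bA' := GRing.isMonoidMorphism.Build D M b bM.
pose b' : {rmorphism D -> M} := HB.pack b bA bA'.
exists D, a, b'; apply/seteqP; split=> [[x y] Gxy|_ [d _ <-]]; last exact: bP.
have /aP[d ad] : x \in S by apply/asboolP; exists y.
by exists d => //; congr pair => //; apply: field_graph_fun gG (bP d) _; rewrite ad.
Qed.

End Graphs.

Section Adjoin.
Variables (D : fieldType) (L : closedFieldType) (M : fieldType).
Variables (a : {rmorphism D -> L}) (b : {rmorphism D -> M}) (w : L) (z : M).

(** Under the hypotheses below, this is the graph of the morphism from D(w) to M that extends [b]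
    and sends [w] to [z]: D[w] is already a field. *)
Definition adjoin_graph : set (L * M) :=
  range (fun p : {poly D} => ((map_poly a p).[w], (map_poly b p).[z])).

Hypothesis wa : algebraicOver a w.
Hypothesis wz : forall p, root (map_poly a p) w -> root (map_poly b p) z.

Lemma adjoin_is_field_graph : field_graph adjoin_graph.
Proof.
have [m [mm irr mP]] := minpoly_ex wa.
have mz : root (map_poly b m) z by apply: wz; rewrite mP.
have inv (p : {poly D}) : exists q : {poly D},
    (map_poly a p).[w]^-1 = (map_poly a q).[w] /\
    (map_poly b p).[z]^-1 = (map_poly b q).[z].
  have [mp|nmp] := boolP (m %| p).
    exists 0; rewrite !rmorph0 !horner0.
    have pw : root (map_poly a p) w by rewrite mP.
    by rewrite (rootP pw) (rootP (wz pw)) !invr0.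
  (* A Bézout relation inverts [p] modulo the irreducible [m], at [w] and at [z] alike. *)
  have : coprimep m p by rewrite irreducible_poly_coprime.
  case/Bezout_eq1_coprimepP=> -[u v] /= uv; exists v.
  have key (R : fieldType) (c : {rmorphism D -> R}) x : root (map_poly c m) x ->
      (map_poly c p).[x]^-1 = (map_poly c v).[x].
    move=> mx; have := congr1 (fun q => (map_poly c q).[x]) uv.
    rewrite rmorphD !rmorphM rmorph1 !hornerE (rootP mx) mulr0 add0r => vp.
    have p0 : (map_poly c p).[x] != 0.
      by apply: contra_eq_neq vp => ->; rewrite mulr0 eq_sym oner_eq0.
    by rewrite -[LHS]mul1r -vp mulfK.
  by split; apply: key => //; rewrite mP.
split.
- by exists 1; rewrite ?rmorph1 ?hornerE.
- by move=> _ _ [p _ <-] [q _ <-]; exists (p - q); rewrite ?rmorphB ?hornerE.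
- move=> _ _ [p _ <-] [q _ <-]; have [r [qw qz]] := inv q.
  by exists (p * r); rewrite /= ?rmorphM ?hornerE ?qw ?qz.
- by move=> y [p _ [pw <-]]; apply/rootP/wz/rootP.
Qed.

Lemma adjoin_graph_base d : adjoin_graph (a d, b d).
Proof. by exists d%:P; rewrite ?map_polyC ?hornerC. Qed.

Lemma adjoin_graph_gen : adjoin_graph (w, z).
Proof. by exists 'X; rewrite ?map_polyX ?hornerX. Qed.

End Adjoin.

Lemma conjugate_ex (D : fieldType) (L M : closedFieldType)
    (a : {rmorphism D -> L}) (b : {rmorphism D -> M}) w :
    algebraicOver a w ->
  exists z, forall p, root (map_poly a p) w -> root (map_poly b p) z.
Proof.
case/minpoly_ex=> m [mm irr mP].
have /closed_rootP[z mz] : size (map_poly b m) != 1.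
  by rewrite size_map_poly neq_ltn irr.1 orbT.
by exists z => p; rewrite mP => mp; apply: root_dvdp mz; rewrite dvdp_map.
Qed.

(** A maximal partial morphism extending [G0] is total: a missing [w] would be algebraic over its
    domain and could be sent to a root in the algebraically closed [M]. *)
Lemma graph_extension (F : fieldType) (L M : closedFieldType)
    (i : {rmorphism F -> L}) (G0 : set (L * M)) :
    (forall w, algebraicOver i w) -> field_graph G0 ->
    (forall c, exists y, G0 (i c, y)) ->
  exists f : {rmorphism L -> M}, forall x y, G0 (x, y) -> f x = y.
Proof.
move=> ialg gG0 iG0; pose P A := field_graph (A `|` G0).
have [F' F'P F't|A [PA Amax]] := @Zorn_bigcup _ P.
  (* Adding the empty set keeps the chain total and makes it non-empty, so that the union with [G0]
     distributes over it. *)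
  pose F0 := F' `|` [set set0].
  have F0P X : F0 X -> P X by case=> [/F'P //|->]; rewrite /P set0U.
  have F0t : total_on F0 subset.
    by move=> X Y [F'X|->] [F'Y|->]; [exact: F't|right|left|left].
  have E : \bigcup_(X in F') X `|` G0 = \bigcup_(X in F0) (X `|` G0).
    apply/seteqP; split=> [u [[X F'X Xu]|G0u]|u [X [F'X|->] [Xu|G0u]]].
    - by exists X; left.
    - by exists set0; right.
    - by left; exists X.
    - by right.
    - by [].
    - by right.
  have two u v : (\bigcup_(X in F0) (X `|` G0)) u ->
      (\bigcup_(X in F0) (X `|` G0)) v ->
      exists X, [/\ F0 X, (X `|` G0) u & (X `|` G0) v].
    move=> [X FX Xu] [Y FY Yv]; have [XY|YX] := F0t _ _ FX FY.
      by exists Y; split=> //; case: Xu => [/XY|]; [left|right].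
    by exists X; split=> //; case: Yv => [/YX|]; [left|right].
  rewrite /P E; split.
  - by exists set0; [right|right; case: gG0].
  - move=> u v Xu Yv; have [Z [FZ Zu Zv]] := two _ _ Xu Yv.
    by exists Z => //; have [_ ZB _ _] := F0P _ FZ; exact: ZB.
  - move=> u v Xu Yv; have [Z [FZ Zu Zv]] := two _ _ Xu Yv.
    by exists Z => //; have [_ _ ZV _] := F0P _ FZ; exact: ZV.
  - by move=> y [Z FZ Zy]; have [_ _ _ Z0] := F0P _ FZ; exact: Z0.
have [D [a [b GE]]] := field_graph_ex PA.
have aP c : exists d, a d = i c.
  have [y G0y] := iG0 c; have : (A `|` G0) (i c, y) by right.
  by rewrite GE => -[d _ [ad _]]; exists d.
have surj w : exists d, a d = w.
  apply: contrapT => nw.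
  have wa : algebraicOver a w.
    apply: algebraicOver_range (ialg w) => _ [c _ <-].
    by have [d <-] := aP c; exists d.
  have [z wz] := conjugate_ex b wa.
  have gG := adjoin_is_field_graph wa wz.
  have sub : A `|` G0 `<=` adjoin_graph a b w z.
    by rewrite GE => _ [d _ <-]; exact: adjoin_graph_base.
  apply: (Amax (adjoin_graph a b w z)).
    split=> [u Au|le]; first by apply: sub; left.
    have : (A `|` G0) (w, z) by left; apply: le; exact: adjoin_graph_gen.
    by rewrite GE => -[d _ [ad _]]; apply: nw; exists d.
  rewrite /P; have -> // : adjoin_graph a b w z `|` G0 = adjoin_graph a b w z.
  by apply/setUidPl => u G0u; apply: sub; right.
have [|g gK] := @rmorphism_lift L D L idfun a.
  by move=> w _; have [d <-] := surj w; exists d.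
have agK d : g (a d) = d by apply: (fmorph_inj a); rewrite gK.
exists (b \o g : {rmorphism L -> M}) => x y G0xy.
have : (A `|` G0) (x, y) by right.
by rewrite GE => -[d _ [<- <-]] /=; rewrite agK.
Qed.

(** * Automorphisms of an algebraic closure *)

Section GalMorphism.
Variables (E : fieldType) (B : set E) (s : gal B).

Let galB : zmod_morphism s.
Proof.
move=> x y; apply: (addIr (s y)).
by rewrite -gal_add !subrK.
Qed.

HB.instance Definition _ := GRing.isZmodMorphism.Build E E s galB.
HB.instance Definition _ := GRing.isMonoidMorphism.Build E E s
  (conj (gal_one s) (gal_mul s)).

End GalMorphism.

Lemma roots_ex (L : closedFieldType) (p : {poly L}) : p != 0 ->
  exists rs, uniq rs /\ forall x, (x \in rs) = root p x.
Proof.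
move=> p0; have [rs pE] := closed_field_poly_normal p.
exists (undup rs); split=> [|x]; first exact: undup_uniq.
by rewrite mem_undup pE rootZ ?lead_coef_eq0 // root_prod_XsubC.
Qed.

Lemma map_poly_fix (D E : fieldType) (a : {rmorphism D -> E})
    (t : {rmorphism E -> E}) p :
  (forall d, t (a d) = a d) -> map_poly t (map_poly a p) = map_poly a p.
Proof. by move=> ta; rewrite -map_poly_comp; apply: eq_map_poly. Qed.

Lemma fix_root (D E : fieldType) (a : {rmorphism D -> E})
    (t : {rmorphism E -> E}) p w :
  (forall d, t (a d) = a d) ->
  root (map_poly a p) w -> root (map_poly a p) (t w).
Proof. by move=> ta; rewrite -{2}(map_poly_fix _ ta) fmorph_root. Qed.

Lemma gal_range (D E : fieldType) (a : {rmorphism D -> E}) (t : gal (range a)) d :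
  t (a d) = a d.
Proof. by apply: gal_fix; exists d. Qed.

Lemma gal_sub (E : fieldType) (B B' : set E) (t : gal B) : B' `<=` B ->
  exists t' : gal B', t' =1 t.
Proof.
move=> BB'; unshelve eexists (@Gal E B' t _ _ _ _ _) => //.
- exact: gal_add.
- exact: gal_mul.
- exact: gal_one.
- exact: gal_bij.
- by move=> x /BB'; exact: gal_fix.
Qed.

Section Automorphisms.
Variables (F : fieldType) (Omega : closedFieldType) (i : {rmorphism F -> Omega}).
Hypothesis ialg : forall w, algebraicOver i w.
Local Notation Aut := (gal (range i)).

(** The finite root set of each polynomial over F is mapped injectively into itself, hence onto
    itself. *)
Lemma algebraic_endo_bij (f : {rmorphism Omega -> Omega}) :
  (forall c, f (i c) = i c) -> bijective f.
Proof.
move=> fi; have /choice[g fg] y : exists x, f x = y.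
  have [p p0 py] := ialg y.
  have ip0 : map_poly i p != 0 by rewrite map_poly_eq0.
  have [rs [urs rsP]] := roots_ex ip0.
  have sub : {subset [seq f x | x <- rs] <= rs}.
    by move=> _ /mapP[x xrs ->]; rewrite rsP fix_root // -rsP.
  have ufrs : uniq [seq f x | x <- rs] by rewrite map_inj_uniq //; exact: fmorph_inj.
  have [|_ fE] := uniq_min_size ufrs sub; first by rewrite size_map.
  have yrs : y \in rs by rewrite rsP.
  by move: yrs; rewrite -fE => /mapP[x _ ->]; exists x.
by exists g => // x; apply: (fmorph_inj f); rewrite fg.
Qed.

Lemma aut_extension (G : set (Omega * Omega)) :
    field_graph G -> (forall c, G (i c, i c)) ->
  exists t : Aut, forall x y, G (x, y) -> t x = y.
Proof.
move=> gG Gi; have [|f fG] := graph_extension ialg gG.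
  by move=> c; exists (i c).
have fi c : f (i c) = i c by apply: fG.
by unshelve eexists (@Gal _ _ f _ _ _ _ _) => //;
  [exact: rmorphD|exact: rmorphM|exact: rmorph1|exact: algebraic_endo_bij
  |move=> _ [c _ <-]].
Qed.

Lemma conjugate_aut w z :
    (forall p, root (map_poly i p) w -> root (map_poly i p) z) ->
  exists t : Aut, t w = z.
Proof.
move=> wz; have gG := adjoin_is_field_graph (ialg w) wz.
have [|t tG] := aut_extension gG; first exact: adjoin_graph_base.
by exists t; apply: tG; exact: adjoin_graph_gen.
Qed.

(* An element [r.[w]] fixed by all automorphisms takes the same value at all  *)
(* conjugates of [w], which are too numerous unless [r] is constant.          *)
Lemma fixed_simple w p q : separable_poly p -> root (map_poly i p) w ->
    (forall t : Aut, t (map_poly i q).[w] = (map_poly i q).[w]) ->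
  range i (map_poly i q).[w].
Proof.
move=> sp pw; have [m [mm irr mP]] := minpoly_ex (ialg w).
have mw : root (map_poly i m) w by rewrite mP.
have sm : separable_poly m by apply: dvdp_separable sp; rewrite -mP.
set x := (map_poly i q).[w] => fx.
(* The remainder has the same value at [w], and its degree is below the number of conjugates of
   [w]. *)
pose r := q %% m.
have xE : x = (map_poly i r).[w].
  by rewrite /x {1}(divp_eq q m) rmorphD rmorphM !hornerE (rootP mw) mulr0 add0r.
have m0 : m != 0 by rewrite monic_neq0.
have im0 : map_poly i m != 0 by rewrite map_poly_eq0.
have [rs rsE] := closed_field_poly_normal (map_poly i m).
move: (rsE); rewrite lead_coef_map (monicP mm) rmorph1 scale1r => mE.
have urs : uniq rs by rewrite -separable_prod_XsubC -mE separable_map.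
have szm : size m = (size rs).+1.
  by rewrite -(size_map_poly i) mE size_prod_XsubC.
have rsP z : (z \in rs) = root (map_poly i m) z by rewrite mE root_prod_XsubC.
have rz z : z \in rs -> (map_poly i r).[z] = x.
  rewrite rsP => mz; have [|t tw] := @conjugate_aut w z.
    by move=> p'; rewrite mP => mp; apply: root_dvdp mz; rewrite dvdp_map.
  rewrite -tw -(map_poly_fix r (gal_range t)) horner_map -xE; exact: fx.
have : map_poly i r - x%:P = 0.
  apply/eqP/negPn/negP => /max_poly_roots/(_ _ urs).
  have -> : all (root (map_poly i r - x%:P)) rs.
    by apply/allP => z /rz zx; rewrite rootE !hornerE zx subrr.
  move=> /(_ isT); rewrite ltnNge => /negP; apply.
  rewrite (leq_trans (size_polyD _ _)) // geq_max size_polyN size_map_poly.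
  rewrite -ltnS -szm ltn_modp m0 (leq_trans (size_polyC_leq1 _)) //.
  by have := irr.1; rewrite szm ltnS.
move=> /subr0_eq /(congr1 (fun u : {poly Omega} => u`_0)).
by rewrite coef_map coefC /= => <-; exists r`_0.
Qed.

End Automorphisms.

(** * Separable elements fixed by all automorphisms *)

Section SeparableFixed.
Variables (F : fieldType) (Omega : closedFieldType) (i : {rmorphism F -> Omega}).
Hypothesis ialg : forall w, algebraicOver i w.
Local Notation Aut := (gal (range i)).

(** The elements are adjoined one at a time. Automorphisms over the intermediate [D] are
    automorphisms over F, so a fixed element of D(w) lies in [D] by [fixed_simple], and induction
    applies. *)
Lemma separable_tower (ws : seq Omega) : {in ws, forall w, separable_over i w} ->
  exists (D : fieldType) (a : {rmorphism D -> Omega}),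
    [/\ range i `<=` range a, {in ws, forall w, range a w} &
        forall x, range a x -> (forall t : Aut, t x = x) -> range i x].
Proof.
elim: ws => [|w ws IH] sws.
  by exists F, i; split.
have [|D [a [ia wsa fa]]] := IH.
  by move=> v vws; apply: sws; rewrite inE vws orbT.
have aalg v : algebraicOver a v by apply: algebraicOver_range (ialg v).
have [p [sp pw]] : separable_over i w by apply: sws; rewrite inE eqxx.
have [p' p'E] : exists p' : {poly D}, map_poly a p' = map_poly i p.
  have [f fP] := rmorphism_lift ia; exists (map_poly f p).
  by rewrite -map_poly_comp (eq_map_poly fP).
have sp' : separable_poly p' by rewrite -(separable_map a) p'E separable_map.
have [D' [a' [b' GE]]] :=
  field_graph_ex (adjoin_is_field_graph (aalg w) (fun _ => id)).
have a'P x : range a' x <-> exists q : {poly D}, (map_poly a q).[w] = x.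
  split=> [[d _ <-]|[q <-]].
    have : graph a' b' (a' d, b' d) by exists d.
    by rewrite -GE => -[q _ [<- _]]; exists q.
  have : adjoin_graph a a w w ((map_poly a q).[w], (map_poly a q).[w]) by exists q.
  by rewrite GE => -[d _ [<- _]]; exists d.
have aa' : range a `<=` range a'.
  by move=> _ [d _ <-]; apply/a'P; exists d%:P; rewrite map_polyC hornerC.
exists D', a'; split.
- by move=> x /ia/aa'.
- move=> v; rewrite inE => /predU1P[->|/wsa/aa'//].
  by apply/a'P; exists 'X; rewrite map_polyX hornerX.
- move=> x /a'P[q <-] fx; apply: fa => //.
  apply: (fixed_simple aalg sp'); first by rewrite p'E.
  by move=> t; have [t' t'E] := gal_sub t ia; rewrite -t'E.
Qed.

Lemma separable_fixed x : x \in least_subfield (contains_separable i) ->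
  (forall t : Aut, t x = x) -> range i x.
Proof.
move=> xsep fx.
(* [gen y ws] expresses that [y] lies in the subfield generated by [ws] over F: each element of the
   separable closure involves only finitely many separable roots. *)
pose gen (y : Omega) (ws : seq Omega) :=
  forall (D : fieldType) (a : {rmorphism D -> Omega}),
  range i `<=` range a -> {in ws, forall w, range a w} -> range a y.
suff [ws sws gx] : exists2 ws, {in ws, forall w, separable_over i w} & gen x ws.
  have [D [a [ia wsa fa]]] := separable_tower sws.
  by apply: fa => //; exact: gx.
pose S : {pred Omega} := [pred x | `[< exists2 ws,
  {in ws, forall w, separable_over i w} & gen x ws >]].
have : x \in S; last by move/asboolP.
have two (op : Omega -> Omega -> Omega) u v :
    (forall (D : fieldType) (a : {rmorphism D -> Omega}) y z,
      range a y -> range a z -> range a (op y z)) ->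
    u \in S -> v \in S -> op u v \in S.
  move=> opP /asboolP[us sus ug] /asboolP[vs svs vg]; apply/asboolP.
  exists (us ++ vs) => [w|D a ia uvs].
    by rewrite mem_cat => /orP[]; [exact: sus|exact: svs].
  by apply: opP; [apply: ug|apply: vg] => // w wi; apply: uvs;
    rewrite mem_cat wi ?orbT.
have /asboolP := xsep; apply; last first.
  move=> w sw; apply/asboolP; exists [:: w] => [v|D a _]; last first.
    by apply; rewrite inE.
  by rewrite inE => /eqP ->.
split=> [|u v|u v].
- by apply/asboolP; exists [::] => // D a _ _; exists 1; rewrite ?rmorph1.
- apply: (two (fun y z => y - z)) => D a _ _ [d _ <-] [e _ <-].
  by exists (d - e); rewrite ?rmorphB.
- apply: (two (fun y z => y / z)) => D a _ _ [d _ <-] [e _ <-].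
  by exists (d / e); rewrite ?fmorph_div.
Qed.

End SeparableFixed.

(* A minimal polynomial with zero derivative is a polynomial in ['X^p].       *)
Lemma separable_power (F : fieldType) (Omega : closedFieldType)
    (i : {rmorphism F -> Omega}) w :
    algebraicOver i w ->
  exists n, separable_over i (w ^+ n) /\ injective (fun x : Omega => x ^+ n).
Proof.
case=> p; have [k] := ubnP (size p); elim: k => // k IH in p w *.
rewrite ltnS => pk p0 pw; have walg : algebraicOver i w by exists p.
have [m [mm irr mP]] := minpoly_ex walg.
have mw : root (map_poly i m) w by rewrite mP.
have [dm0|dm0] := eqVneq (m^`()) 0; last first.
  exists 1%N; rewrite expr1; split; last by move=> x y; rewrite !expr1.
  exists m; split=> //; rewrite separable_poly.unlock irreducible_poly_coprime //.
  by apply: contra_ltnN (lt_size_deriv (monic_neq0 mm)) => /dvdp_leq; apply.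
have szm : (1 < size m)%N by have := irr.1.
have mk j : m`_j *+ j = 0.
  by case: j => [|j]; rewrite ?mulr0n // -coef_deriv dm0 coef0.
have [q qF] : exists q, q \in [pchar F].
  apply: (@GRing.natf0_pchar F (size m).-1); first by rewrite -subn1 subn_gt0.
  by have /eqP := mk (size m).-1; rewrite -lead_coefE (monicP mm).
have q1 : (1 < q)%N by rewrite prime_gt1 // (pcharf_prime qF).
have q0 : (0 < q)%N by apply: ltnW.
pose g := \poly_(j < size m) m`_(j * q).
have gE : g \Po 'X^q = m.
  apply/polyP => j; rewrite coef_comp_poly_Xn //.
  case: ifP => [/dvdnP[l ->]|/negP ndv].
    rewrite mulnK // coef_poly; case: ltnP => // lm.
    by rewrite nth_default // (leq_trans lm) // leq_pmulr.
  have /eqP := mk j; rewrite -mulr_natr mulf_eq0 => /orP[/eqP->//|].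
  by rewrite -(dvdn_pcharf qF) => /ndv.
have gw : root (map_poly i g) (w ^+ q).
  by rewrite -gE map_comp_poly map_polyXn in mw; rewrite rootE -hornerXn -horner_comp.
have g0 : g != 0.
  apply: contraTneq mm => g0.
  by rewrite -gE g0 comp_poly0 monicE lead_coef0 eq_sym oner_eq0.
have szg : (size g < k)%N.
  have mg : (size m).-1 = ((size g).-1 * q)%N.
    by rewrite -gE size_comp_poly size_polyXn.
  have mp : (size m <= size p)%N by apply: dvdp_leq => //; rewrite -mP.
  have g1 : (0 < (size g).-1)%N.
    have : (0 < (size m).-1)%N by rewrite -subn1 subn_gt0.
    by rewrite mg muln_gt0 => /andP[].
  have gm : ((size g).-1 < (size m).-1)%N by rewrite mg ltn_Pmulr.
  rewrite -(@prednK (size g)) ?size_poly_gt0 //.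
  by rewrite (leq_trans _ (leq_trans mp pk)) // -ltn_predRL.
have [n [sn ninj]] := IH _ _ szg g0 gw.
exists (q * n)%N; rewrite exprM; split=> // x y; rewrite !exprM => /ninj.
have qO : q \in [pchar Omega] by rewrite (fmorph_pchar i).
by rewrite -!(pFrobenius_autE qO) => /fmorph_inj.
Qed.

(** * Galois groups *)

Section Profinite.
Variables (E : fieldType) (B : set E).
Local Notation G := (gal B).

Lemma nbhs_gal (s : G) x : nbhs s [set t : G | t x = s x].
Proof. by exists [:: x] => t; apply; rewrite inE. Qed.

Lemma gal_neq (s t : G) : s <> t -> exists x, s x <> t x.
Proof.
by move=> st; apply: contrapT => /forallNP E0; apply: st; apply: galP => x;
  apply: contrapT; exact: E0.
Qed.

Lemma gal_hausdorff : hausdorff_space G.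
Proof.
move=> s t st; apply: contrapT => /gal_neq[x sx].
by have [u [us ut]] := st _ _ (nbhs_gal s x) (nbhs_gal t x); apply: sx; rewrite -us.
Qed.

Lemma gal_zero_dimensional : zero_dimensional G.
Proof.
move=> s t /eqP/gal_neq[x sx]; exists [set u : G | u x = s x]; split=> //.
  split; first by rewrite openE => u us; rewrite /interior /= -us; exact: nbhs_gal.
  rewrite -[X in closed X]setCK; apply: open_closedC; rewrite openE => u us.
  have := nbhs_gal u x; apply: filterS => v /= vu; apply: contra_not us => /= <-.
  exact/esym.
by move=> /esym.
Qed.

(** An ultrafilter contains one cell of any finite partition. *)
Lemma ultra_finite_value (T : Type) (V : eqType) (U : set_system T)
    (f : T -> V) (rs : seq V) :
  UltraFilter U -> (forall s, f s \in rs) -> exists y, U [set s | f s = y].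
Proof.
move=> uU frs; have : U [set s | f s \in rs].
  by apply: filterS filterT => s _; exact: frs.
elim: rs {frs} => [U0|y rs IH Ur].
  by have [s] := filter_ex U0.
have [|nU] := in_ultra_setVsetC [set s | f s = y] uU; first by exists y.
apply: IH; apply: filterS (filterI Ur nU) => s /= [].
by rewrite inE => /predU1P[->|].
Qed.

(* Along an ultrafilter each orbit, being finite, is eventually constant: the *)
(* limit is the pointwise one.                                                *)
Lemma gal_compact : (forall x, exists rs : seq E, forall t : G, t x \in rs) ->
  compact [set: G].
Proof.
move=> orb; rewrite compact_ultra => U uU _.
have /choice[g gP] x : exists y, U [set s : G | s x = y].
  by have [rs rsP] := orb x; exact: (ultra_finite_value uU rsP).
(* The limit of the inverses is taken as well: it provides the inverse of the limit [g]. *)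
have /choice[h hP] y : exists x, U [set s : G | gal_inv s y = x].
  by have [rs rsP] := orb y; apply: (ultra_finite_value uU) => s; exact: rsP.
have gD : {morph g : x y / x + y}.
  move=> x y; have [s /= [[sx sy] sxy]] :=
    filter_ex (filterI (filterI (gP x) (gP y)) (gP (x + y))).
  by rewrite -sx -sy -sxy gal_add.
have gM : {morph g : x y / x * y}.
  move=> x y; have [s /= [[sx sy] sxy]] :=
    filter_ex (filterI (filterI (gP x) (gP y)) (gP (x * y))).
  by rewrite -sx -sy -sxy gal_mul.
have g1 : g 1 = 1.
  by have [s /= <-] := filter_ex (gP 1); rewrite gal_one.
have gfix x : B x -> g x = x.
  by move=> Bx; have [s /= <-] := filter_ex (gP x); rewrite gal_fix.
have hK : cancel h g.
  move=> y; have [s /= [<- sy]] := filter_ex (filterI (gP (h y)) (hP y)).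
  by rewrite -sy gal_invK.
have gK : cancel g h.
  move=> x; have [s /= [sx <-]] := filter_ex (filterI (gP x) (hP (g x))).
  by apply: (bij_inj (gal_bij s)); rewrite gal_invK.
exists (Gal gD gM g1 (Bijective gK hK) gfix); split=> // A [X XA].
have UX : U [set t : G | {in X, t =1 g}].
  elim: X {XA} => [|x X IH]; first by apply: filterS filterT.
  apply: filterS (filterI (gP x) IH) => t /= [tx tX] y.
  by rewrite inE => /predU1P[->|/tX].
by apply: filterS UX => t; exact: XA.
Qed.

Lemma gal_profinite : (forall x, exists rs : seq E, forall t : G, t x \in rs) ->
  profinite G.
Proof.
move=> orb; split; [exact: gal_hausdorff|exact: gal_compact|].
exact/zero_dimension_totally_disconnected/gal_zero_dimensional.
Qed.

End Profinite.

(** * Passing between [Omega] and its stable subfields *)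

Section Restriction.
Variables (F : fieldType) (Omega : closedFieldType) (i : {rmorphism F -> Omega}).
Hypothesis ialg : forall w, algebraicOver i w.
Local Notation Aut := (gal (range i)).

Definition aut_stable (P : {pred Omega} -> Prop) : Prop :=
  forall t : Aut, {homo t : x / x \in least_subfield P}.

(** Pure inseparability: some power of [w] is separable, and raising to that power is injective. *)
Lemma aut_eq_on_separable (t t' : Aut) :
  {in least_subfield (contains_separable i), t =1 t'} -> t =1 t'.
Proof.
move=> tt' w; have [n [sn ninj]] := separable_power (ialg w).
apply: ninj; rewrite /= -!rmorphXn; apply: tt'.
by apply/asboolP => E _; apply.
Qed.

(** The preimage under [t] of a subfield containing the separable elements is again one, since [t]
    preserves the roots of a polynomial over F. *)
Lemma separable_stable : aut_stable (contains_separable i).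
Proof.
move=> t x xs; apply/asboolP => E [E1 EB EV] sE.
have /asboolP/(_ [pred y | t y \in E]) := xs; apply.
  split=> [|y z|y z]; rewrite !inE ?rmorph1 ?rmorphB ?fmorph_div //.
    exact: EB.
  exact: EV.
move=> w [p [sp pw]]; apply: sE; exists p; split=> //.
by apply: fix_root => //; exact: gal_range.
Qed.

Lemma separable_base c : i c \in least_subfield (contains_separable i).
Proof.
apply/asboolP => E _; apply; exists ('X - c%:P); split.
  by have := separable_prod_XsubC [:: c]; rewrite big_seq1 => ->.
by rewrite rmorphB /= map_polyX map_polyC root_XsubC.
Qed.

Section Normal.
Variables (K : fieldType) (j : {rmorphism K -> Omega}).

Lemma normal_stable : aut_stable (normal_containing i j).
Proof.
move=> t x xs; apply/asboolP => E dE nE.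
have [[_ _ _ conjE] _] := nE.
have [m [_ irr mP]] := minpoly_ex (ialg x).
have mx : root (map_poly i m) x by rewrite mP.
apply: (conjE m irr x) => //; last by apply: fix_root => //; exact: gal_range.
by have /asboolP/(_ E dE nE) := xs.
Qed.

Lemma normal_base c : i c \in least_subfield (normal_containing i j).
Proof. by apply/asboolP => E _ [[]]. Qed.

Lemma normal_sub x : j x \in least_subfield (normal_containing i j).
Proof. by apply/asboolP => E _ [_]. Qed.

End Normal.

Section Over.
Variable P : {pred Omega} -> Prop.

Lemma restrict_ex (t : Aut) : aut_stable P ->
  exists s : Gal_over i P, forall x, val (s x) = t (val x).
Proof.
move=> st.
pose f (u : Aut) (x : least_field P) : least_field P :=
  exist _ (u (val x)) (st u _ (valP x)).
have fD : {morph f t : x y / x + y} by move=> x y; apply: val_inj; rewrite /= gal_add.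
have fM : {morph f t : x y / x * y} by move=> x y; apply: val_inj; rewrite /= gal_mul.
have f1 : f t 1 = 1 by apply: val_inj; rewrite /= gal_one.
have fb : bijective (f t).
  exists (f (gal_inv t)) => x; apply: val_inj; rewrite /= ?gal_invK //.
  by apply: (bij_inj (gal_bij t)); rewrite gal_invK.
have ffix (x : least_field P) : range i (val x) -> f t x = x.
  by move=> ix; apply: val_inj; exact: gal_fix.
by exists (Gal fD fM f1 fb ffix).
Qed.

Hypothesis Pbase : forall c, i c \in least_subfield P.

Lemma extend_ex (s : Gal_over i P) : exists t : Aut, forall x, t (val x) = val (s x).
Proof.
pose s' : {rmorphism least_field P -> least_field P} := s : gal _.
(* The graph of [s] is a partial automorphism of [Omega]; it contains the diagonal of F because of
   [Pbase]. *)
have [|t tG] := aut_extension ialg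
    (graph_is_field_graph (val : {rmorphism least_field P -> Omega}) (val \o s')).
  move=> c; pose x : least_field P := exist _ (i c) (Pbase c).
  exists x => //=; congr pair; have -> // : s x = x.
  by apply: gal_fix; exists c.
by exists t => x; apply: tG; exists x.
Qed.

Lemma Gal_over_orbit (x : least_field P) :
  exists rs : seq (least_field P), forall s : Gal_over i P, s x \in rs.
Proof.
have [p p0 px] := ialg (val x).
have ip0 : map_poly i p != 0 by rewrite map_poly_eq0.
have [rs [_ rsP]] := roots_ex ip0.
exists (pmap insub rs) => s; rewrite mem_pmap_sub rsP.
have [t tE] := extend_ex s; rewrite -[X in root _ X]/(val _) -tE.
by apply: fix_root => //; exact: gal_range.
Qed.

Lemma Gal_over_profinite : profinite (Gal_over i P).
Proof. exact: (gal_profinite Gal_over_orbit). Qed.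

End Over.
End Restriction.

(** * The restriction map *)

Lemma map_prod_XsubC_fix (R : idomainType) (t : {rmorphism R -> R}) (s : seq R) :
    injective t -> uniq s -> {homo t : z / z \in s} ->
  map_poly t (\prod_(z <- s) ('X - z%:P)) = \prod_(z <- s) ('X - z%:P).
Proof.
move=> tI us ts; rewrite rmorph_prod /=.
under eq_bigr do rewrite rmorphB /= map_polyX map_polyC.
rewrite -(big_map t predT (fun z => 'X - z%:P)); apply: perm_big.
have uts : uniq [seq t z | z <- s] by rewrite map_inj_uniq.
have sub : {subset [seq t z | z <- s] <= s} by move=> _ /mapP[z /ts tz ->].
have [|_ tsE] := uniq_min_size uts sub; first by rewrite size_map.
exact: uniq_perm.
Qed.

(* A finite family is encoded by the polynomial with these coefficients, whose *)
(* orbit under [N] is the set of roots of an [N]-invariant polynomial.         *)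
Lemma closed_subgroup_full (E : fieldType) (B : set E) (N : {pred gal B}) :
    (forall x, exists rs : seq E, forall t : gal B, t x \in rs) ->
    group_closed N -> closed [set` N] ->
    (forall x, (forall n, n \in N -> n x = x) -> forall t : gal B, t x = x) ->
  [set` N] = [set: gal B].
Proof.
move=> orb [N1 Ndiv] Ncl fixN; have NM := group_closedM (conj N1 Ndiv).
apply/seteqP; split=> // s _; apply: Ncl => A [X XA].
have [Os OsP] : exists Os : seq (seq E), forall t : gal B, map t X \in Os.
  elim: X {XA} => [|x X [Os OsP]]; first by exists [:: [::]] => t; rewrite inE.
  have [rs rsP] := orb x; exists [seq y :: Y | y <- rs, Y <- Os] => t.
  by rewrite /=; apply: allpairs_f; [exact: rsP|exact: OsP].
pose O := undup [seq Poly Y | Y <- Os & `[< exists2 n, n \in N & map n X = Y >]].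
have OP q : q \in O <-> exists2 n, n \in N & q = Poly (map n X).
  rewrite mem_undup; split=> [/mapP[Y]|[n nN ->]].
    by rewrite mem_filter => /andP[/asboolP[n nN <-] _] ->; exists n.
  by apply: map_f; rewrite mem_filter OsP andbT; apply/asboolP; exists n.
(* [Poly] drops trailing zeros, which loses nothing: coefficients beyond the end read as 0. *)
have mapPoly (t : gal B) (Y : seq E) : map_poly t (Poly Y) = Poly (map t Y).
  apply/polyP => k; rewrite coef_map !coef_Poly.
  have [kY|Yk] := ltnP k (size Y); first by rewrite (nth_map 0).
  have -> : Y`_k = 0 by exact: nth_default.
  by rewrite [LHS](rmorph0 t) nth_default ?size_map.
have polyI (t : gal B) : injective (map_poly t : {poly E} -> {poly E}).
  exact/map_poly_inj.
have uO : uniq O by rewrite /O undup_uniq.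
pose Phi := \prod_(q <- O) ('X - q%:P).
have PhiN n : n \in N -> map_poly (map_poly n) Phi = Phi.
  move=> nN; apply: map_prod_XsubC_fix => //; first exact: polyI.
  move=> _ /OP[n' n'N ->]; apply/OP; exists (n * n')%g; first exact: NM.
  by rewrite /= mapPoly -map_comp.
(* Every coefficient of a coefficient of [Phi] is fixed by [N], hence by [s]. *)
have Phis : map_poly (map_poly s) Phi = Phi.
  apply/polyP => a; apply/polyP => b; rewrite !coef_map; apply: fixN => n nN.
  by rewrite -[in RHS](PhiN n nN) !coef_map.
have : root Phi (map_poly s (Poly X)).
  rewrite -Phis; apply: rmorph_root; rewrite root_prod_XsubC; apply/OP.
  by exists 1%g => //; rewrite map_id.
rewrite root_prod_XsubC => /OP[n nN]; rewrite mapPoly => snX.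
exists n; split=> //; apply: XA => x xX.
have kX : (index x X < size X)%N by rewrite index_mem.
have := congr1 (fun q : {poly E} => q`_(index x X)) snX.
by rewrite !coef_Poly !(nth_map 0) // !nth_index.
Qed.

Section FrattiniCover.
Variables (F K : fieldType) (Omega : closedFieldType).
Variables (iota : {rmorphism F -> K}) (j : {rmorphism K -> Omega}).
Local Notation i := (j \o iota : {rmorphism F -> Omega}).
Hypothesis ialg : forall w, algebraicOver i w.
Local Notation Aut := (gal (range i)).

Lemma restriction_ex : exists r : absGal i -> normal_Gal i j, is_restriction r.
Proof.
suff /choice[r rP] (s : absGal i) : exists (r : normal_Gal i j), exists t : Aut,
    (forall x : sep_closure i, t (val x) = val (s x)) /\
    (forall x : normal_closure i j, t (val x) = val (r x)).
  by exists r => s; exact: rP.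
have [t ts] := extend_ex ialg (@separable_base _ _ i) s.
have [r rt] := restrict_ex t (@normal_stable _ _ _ ialg _ j).
by exists r, t; split=> // x; rewrite rt.
Qed.

Section Epi.
Variable r : absGal i -> normal_Gal i j.
Hypothesis rP : is_restriction r.

(** Any extension of [s] to [Omega] computes [r s], since two extensions agree by
    [aut_eq_on_separable]. *)
Lemma restriction_eq (s : absGal i) (t : Aut) :
  (forall x : sep_closure i, t (val x) = val (s x)) ->
  forall x : normal_closure i j, val (r s x) = t (val x).
Proof.
move=> ts x; have [t' [t's t'r]] := rP s; rewrite -t'r.
apply: (aut_eq_on_separable ialg) => w wsep.
by rewrite -[w]/(val (exist _ w wsep : sep_closure i)) ts t's.
Qed.

Lemma restriction_unique r' : is_restriction r' -> r = r'.
Proof.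
move=> r'P; apply/funext => s; apply: galP => x; apply: val_inj.
by have [t [ts <-]] := r'P s; exact: restriction_eq.
Qed.

Lemma restriction_morph : {morph r : s t / (s * t)%g}.
Proof.
move=> s s'; apply: galP => x; apply: val_inj.
have [t [ts tr]] := rP s; have [t' [t's t'r]] := rP s'.
rewrite (@restriction_eq _ (t * t')%g) => [/=|y].
  by rewrite t'r tr.
by rewrite /= t's ts.
Qed.

(* A suitable power of each element of the normal closure is separable.       *)
Lemma restriction_continuous : continuous r.
Proof.
move=> s U [X XU].
have /choice[y yP] (x : normal_closure i j) : exists y : sep_closure i,
    exists n, val y = val x ^+ n /\ injective (fun z : Omega => z ^+ n).
  have [n [sn ninj]] := separable_power (ialg (val x)).
  have xn : val x ^+ n \in least_subfield (contains_separable i).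
    by apply/asboolP => E _; apply.
  pose z : sep_closure i := exist _ (val x ^+ n) xn.
  by exists z, n.
exists (map y X) => s' s's; apply: XU => x xX; apply: val_inj.
have [n [yn ninj]] := yP x; apply: ninj.
have [t [ts tr]] := rP s; have [t' [t's t'r]] := rP s'.
by rewrite /= -tr -t'r -(rmorphXn t) -(rmorphXn t') /= -yn ts t's s's // map_f.
Qed.

Lemma restriction_surj (q : normal_Gal i j) : exists s, r s = q.
Proof.
have [t tq] := extend_ex ialg (@normal_base _ _ i _ j) q.
have [s st] := restrict_ex t (@separable_stable _ _ i).
exists s; apply: galP => x; apply: val_inj.
by rewrite (@restriction_eq s t).
Qed.

Lemma restriction_epi : profinite_epi r.
Proof.
split.
- exact: (Gal_over_profinite ialg (@separable_base _ _ i)).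
- exact: (Gal_over_profinite ialg (@normal_base _ _ i _ j)).
- exact: restriction_morph.
- exact: restriction_continuous.
- exact: restriction_surj.
Qed.

(* Modulo [N] every automorphism over [F] fixes [K], so the conjugates of [x] *)
(* over [F] are already conjugate over [K].                                   *)
Lemma frattini_minpoly (N : {pred absGal i}) (x : sep_closure i) (m : {poly K}) :
    r @` [set` N] = [set: normal_Gal i j] -> (forall n, n \in N -> n x = x) ->
    m \is monic -> (forall q, root (map_poly j q) (val x) = (m %| q)) ->
  exists f : {poly F}, m = map_poly iota f.
Proof.
move=> rN xN mm mP; have mx : root (map_poly j m) (val x) by rewrite mP.
(* [t] agrees on the normal closure with an extension [u] of some [n] in [N]; then [t * gal_inv u]
   fixes K and sends [x] to [t x]. *)
have mAut (t : Aut) : root (map_poly j m) (t (val x)).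
  have [s st] := restrict_ex t (@separable_stable _ _ i).
  have : (r @` [set` N]) (r s) by rewrite rN.
  move=> [n nN rn]; have [u [un ur]] := rP n.
  have tu y : y \in least_subfield (normal_containing i j) -> t y = u y.
    move=> ync; pose y' : normal_closure i j := exist _ y ync.
    have := @restriction_eq s t _ y'; rewrite -rn -[val _]/(val (r n y')) -ur /=.
    by move=> -> // z; rewrite st.
  have ux : gal_inv u (val x) = val x.
    by apply: (bij_inj (gal_bij u)); rewrite gal_invK un xN.
  have fixK c : (t * gal_inv u)%g (j c) = j c.
    have ujc : gal_inv u (j c) \in least_subfield (normal_containing i j).
      by apply: (@normal_stable _ _ _ ialg _ j (gal_inv u)); exact: normal_sub.
    by rewrite -[LHS]/(t (gal_inv u (j c))) tu // gal_invK.
  have := fix_root fixK mx.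
  by rewrite -[X in root _ X]/(t (gal_inv u (val x))) ux.
have [p p0 px] := ialg (val x).
have ip0 : map_poly i p != 0 by rewrite map_poly_eq0.
have [rs [urs rsP]] := roots_ex ip0.
pose O := [seq z <- rs | `[< exists t : Aut, t (val x) = z >]].
have OP z : z \in O <-> exists t : Aut, t (val x) = z.
  rewrite mem_filter; split=> [/andP[/asboolP//]|[t tx]].
  apply/andP; split; first by apply/asboolP; exists t.
  by rewrite rsP -tx; apply: fix_root => //; exact: gal_range.
have uO : uniq O by rewrite filter_uniq.
(* The minimal polynomial of [x] over F: its coefficients lie in the separable closure and are fixed
   by all automorphisms. *)
pose f := \prod_(z <- O) ('X - z%:P).
have ft (t : Aut) : map_poly t f = f.
  apply: map_prod_XsubC_fix => //; first exact: fmorph_inj.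
  by move=> _ /OP[u <-]; apply/OP; exists (t * u)%g.
have fsep : f \is a polyOver (least_subfield (contains_separable i)).
  rewrite /f big_seq; apply: rpred_prod => z /OP[t <-].
  by rewrite polyOverXsubC separable_stable //; exact: valP.
have [f0 f0E] : exists f0, map_poly i f0 = f.
  apply: map_poly_lift => l; apply: (separable_fixed ialg).
    exact: (polyOverP fsep).
  by move=> t; rewrite -[in RHS](ft t) coef_map.
exists f0; apply: (map_poly_inj j); rewrite -map_poly_comp f0E.
(* Both are monic. [m] divides [f] because [x] is a root of [f]; [f] divides [m] because its roots
   are simple and are roots of [m]. *)
apply/eqP; rewrite -eqp_monic ?map_monic ?monic_prod_XsubC //.
apply/andP; split.
  rewrite -f0E (map_poly_comp j iota) dvdp_map -mP -map_poly_comp f0E.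
  by rewrite root_prod_XsubC; apply/OP; exists 1%g.
apply: uniq_roots_dvdp; last by rewrite uniq_rootsE.
by apply/allP => _ /OP[t <-].
Qed.

End Epi.
End FrattiniCover.

(** * Invariants of a g-field *)

Section Tensors.
Variables (k : fieldType) (H : hopf_algebra k).
Local Notation e := (vbasis {:H}).

Lemma coord_basis (n m : 'I_(\dim {:H})) : coord e n e`_m = (n == m)%:R.
Proof. by rewrite coord_free ?(basis_free (vbasisP _)) // eq_sym. Qed.

Section Module.
Variable A : lmodType k.

Lemma pure0l h : pure (0 : A) h = 0 :> tensor A H.
Proof. by rewrite -[X in pure X _](scale0r 0) pureZl scale0r. Qed.

Lemma pure_suml I r (P : pred I) (F : I -> A) h :
  pure (\sum_(j <- r | P j) F j) h = \sum_(j <- r | P j) pure (F j) h :> tensor A H.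
Proof.
by elim/big_rec2: _ => [|j x y _ <-]; rewrite ?pure0l ?pureDl.
Qed.

Lemma tcoef_tlift_pure (V : lmodType k) (g : 'I_(\dim {:H}) -> V) n :
  tcoef (\sum_m pure (g m) e`_m : tensor V H) n = g n.
Proof.
rewrite tcoef_sum (bigD1 n) //= big1 => [|m mn].
  by rewrite tcoef_pure coord_basis eqxx scale1r addr0.
by rewrite tcoef_pure coord_basis eq_sym (negPf mn) scale0r.
Qed.

(* Coassociativity of [d], read off the second factor of [(A ⊗ H) ⊗ H].       *)
Lemma coassocE (d : A -> tensor A H) x :
  tlift (fun y h => tlift (fun h1 h2 => pure (pure y h1) h2) (comul H h)) (d x)
    = tlift (fun y h => pure (d y) h) (d x) <->
  forall n, d (tcoef (d x) n)
    = \sum_m pure (tcoef (d x) m) (tcoef (comul H e`_m) n).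
Proof.
have L n : tcoef (tlift (fun y h =>
      tlift (fun h1 h2 => pure (pure y h1) h2) (comul H h)) (d x)) n
    = \sum_m pure (tcoef (d x) m) (tcoef (comul H e`_m) n).
  by rewrite tcoef_sum; apply: eq_bigr => m _; rewrite /tlift tcoef_tlift_pure.
have R n : tcoef (tlift (fun y h => pure (d y) h) (d x)) n = d (tcoef (d x) n).
  by rewrite /tlift tcoef_tlift_pure.
split=> [E n|E]; first by rewrite -R -L E.
by apply: tensorP => n; rewrite L R E.
Qed.

End Module.

Lemma pureM (A : algType k) (a b : A) (g h : H) :
  pure a g * pure b h = pure (a * b) (g * h) :> tensor A H.
Proof. exact: tensor_mul_pure. Qed.

Lemma tensor_mul_sum (A : algType k) (I : finType) (u : tensor A H) (y : I -> A)
    (g : I -> H) :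
  u * (\sum_m pure (y m) (g m)) = \sum_n \sum_m pure (tcoef u n * y m) (e`_n * g m).
Proof.
rewrite [u in LHS]tensorE /tlift mulr_suml; apply: eq_bigr => n _.
by rewrite mulr_sumr; apply: eq_bigr => m _; rewrite pureM.
Qed.

Lemma tcoef_mul_pure1 (A : algType k) (u : tensor A H) b n :
  tcoef (u * pure b 1) n = tcoef u n * b.
Proof.
rewrite [u in LHS]tensorE /tlift mulr_suml.
under eq_bigr do rewrite pureM mulr1.
by rewrite (tcoef_tlift_pure (fun m => tcoef u m * b)).
Qed.

(* [h_1 S(h_2) ⊗ h_3 = 1 ⊗ h].                                                *)
Lemma comul_antipode (h : H) :
  tlift (fun g l => tlift (fun l1 l2 => pure (g * antipode H l1) l2) (comul H l))
    (comul H h) = pure 1 h.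
Proof.
pose s (u : tensor H H) : H := tlift (fun g g' => g * antipode H g') u.
(* [Psi] sends g ⊗ g' ⊗ l to g S(g') ⊗ l. Coassociativity moves it to the form of the iterated
   coproduct where the antipode axiom applies. *)
pose Psi (u : tensor (tensor H H) H) : tensor H H := tlift (fun u l => pure (s u) l) u.
have sl : linear s.
  by apply: tlift_is_linear => g' c x y; rewrite mulrDl scalerAl.
have Pl : linear Psi.
  by apply: tlift_is_linear => l c x y; rewrite sl pureDl pureZl.
have Psum I r (P : pred I) (f : I -> tensor (tensor H H) H) :
    Psi (\sum_(j <- r | P j) f j) = \sum_(j <- r | P j) Psi (f j).
  apply: (big_morph Psi) => [x y|]; first by have := Pl 1 x y; rewrite !scale1r.
  by have := Pl (-1) 0 0; rewrite scaler0 addr0 scaleN1r addNr.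
have Ppure u l : Psi (pure u l) = pure (s u) l.
  rewrite /Psi tliftE // => [l' c x y|v c x y]; first by rewrite sl pureDl pureZl.
  by rewrite pureDr pureZr.
have spure g g' : s (pure g g') = g * antipode H g'.
  rewrite /s tliftE // => [l' c x y|v c x y]; first by rewrite mulrDl scalerAl.
  by rewrite linearP mulrDr scalerAr.
have := congr1 Psi (comulA h); rewrite {1}/tlift Psum => E.
transitivity (Psi (tlift (fun g l => pure (comul H g) l) (comul H h))).
  rewrite -E; apply: eq_bigr => n _; rewrite /tlift Psum.
  by apply: eq_bigr => m _; rewrite Ppure spure.
rewrite /tlift Psum -[h in RHS]comul_counitl /tlift pure_sumr.
by apply: eq_bigr => n _; rewrite Ppure [s _]antipoder pureZl pureZr.
Qed.

End Tensors.

(** * Algebraicity over the invariants *)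

Section Invariants.
Variables (k : fieldType) (H : hopf_algebra k) (K : gfield H).
Local Notation A := (algebra_of (gfield_in K)).
Local Notation e := (vbasis {:H}).
Local Notation d := (coact K).

Lemma invariantsE (x : A) :
  (x \in @invariants k H K) <-> forall n, tcoef (d x) n = coord e n 1 *: x.
Proof.
split=> [/eqP E n|E]; first by rewrite E tcoef_pure.
by apply/eqP/tensorP => n; rewrite E tcoef_pure.
Qed.

Lemma coact_tcoef (x : A) n : d (tcoef (d x) n)
  = \sum_m pure (tcoef (d x) m) (tcoef (comul H e`_m) n).
Proof. exact: (proj1 (coassocE _ _) (coactA x)). Qed.

Lemma coact0 : d 0 = 0. Proof. exact: rmorph0. Qed.

Lemma coactM (x y : A) : d (x * y) = d x * d y. Proof. exact: rmorphM. Qed.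

Lemma coact_sum I r (P : pred I) (f : I -> A) :
  d (\sum_(j <- r | P j) f j) = \sum_(j <- r | P j) d (f j).
Proof. exact: rmorph_sum. Qed.

(* Apply [d] to the relation, then undo the twist [g ⊗ h |-> g h_1 ⊗ h_2].    *)
Lemma coact_relation (I : finType) (p x : I -> A) :
    (forall n, \sum_i p i * tcoef (d (x i)) n = 0) ->
  forall a m, \sum_i tcoef (d (p i)) a * tcoef (d (x i)) m = 0.
Proof.
move=> rel; pose Y a m := \sum_i tcoef (d (p i)) a * tcoef (d (x i)) m.
(* The vanishing of the sum of all Y_am ⊗ e_a (e_m)_1 ⊗ (e_m)_2, read off in the last factor. *)
have Yn n : \sum_a \sum_m pure (Y a m) (e`_a * tcoef (comul H e`_m) n)
    = 0 :> tensor A H.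
  rewrite -[RHS]coact0 -(rel n) coact_sum.
  under [RHS]eq_bigr do rewrite coactM coact_tcoef tensor_mul_sum.
  rewrite [RHS]exchange_big; apply: eq_bigr => a _ /=.
  rewrite exchange_big; apply: eq_bigr => m _ /=.
  by rewrite pure_suml.
(* [s l] sends y ⊗ g to y ⊗ g S(l_1) ⊗ l_2; by [comul_antipode] it undoes the twist and leaves Y_am
   ⊗ e_a ⊗ e_m, as [W] records. *)
pose s (l : H) (u : tensor A H) : tensor (tensor A H) H :=
  tlift (fun y g => tlift (fun l1 l2 => pure (pure y (g * antipode H l1)) l2)
                          (comul H l)) u.
have sl l : linear (s l).
  apply: tlift_is_linear => g c u v; rewrite /tlift scaler_sumr -big_split /=.
  by apply: eq_bigr => n _; rewrite -pureZl -pureDl -pureZl -pureDl.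
have spure l y g : s l (pure y g)
    = tlift (fun l1 l2 => pure (pure y (g * antipode H l1)) l2) (comul H l).
  rewrite /s tliftE // => [g' c u v|y' c u v];
    rewrite /tlift scaler_sumr -big_split /=; apply: eq_bigr => n _.
    by rewrite -pureZl -pureDl -pureZl -pureDl.
  by rewrite -pureZl -pureDl -pureZr -pureDr mulrDl scalerAl.
have ssum l J r (P : pred J) (f : J -> tensor A H) :
    s l (\sum_(j <- r | P j) f j) = \sum_(j <- r | P j) s l (f j).
  apply: (big_morph (s l)) => [u v|]; first by have := sl l 1 u v; rewrite !scale1r.
  by have := sl l (-1) 0 0; rewrite scaler0 addr0 scaleN1r addNr.
have W (a m : 'I_(\dim {:H})) :
    \sum_(n < \dim {:H}) s e`_n (pure (Y a m) (e`_a * tcoef (comul H e`_m) n))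
    = pure (pure (Y a m) e`_a) e`_m.
  pose J (u : tensor H H) : tensor (tensor A H) H :=
    tlift (fun g l => pure (pure (Y a m) (e`_a * g)) l) u.
  have Jb g c u v : pure (pure (Y a m) (e`_a * (c *: u + v))) g
      = c *: pure (pure (Y a m) (e`_a * u)) g + pure (pure (Y a m) (e`_a * v)) g
      :> tensor (tensor A H) H.
    by rewrite -pureZl -pureDl -pureZr -pureDr mulrDr scalerAr.
  have Jl : linear J by apply: tlift_is_linear => g c u v; exact: Jb.
  have Jsum L r (P : pred L) (f : L -> tensor H H) :
      J (\sum_(j <- r | P j) f j) = \sum_(j <- r | P j) J (f j).
    apply: (big_morph J) => [u v|]; first by have := Jl 1 u v; rewrite !scale1r.
    by have := Jl (-1) 0 0; rewrite scaler0 addr0 scaleN1r addNr.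
  have Jpure g l : J (pure g l) = pure (pure (Y a m) (e`_a * g)) l.
    rewrite /J tliftE // => y' c u v.
    by rewrite pureDr pureZr.
  have := congr1 J (comul_antipode e`_m).
  rewrite Jpure mulr1 => <-; rewrite [in RHS]/tlift Jsum; apply: eq_bigr => n _.
  rewrite spure /tlift Jsum; apply: eq_bigr => q _.
  by rewrite Jpure mulrA.
have Z : \sum_(a < \dim {:H}) \sum_(m < \dim {:H})
    pure (pure (Y a m) e`_a) e`_m = 0 :> tensor (tensor A H) H.
  transitivity (\sum_(n < \dim {:H}) s e`_n 0); last first.
    rewrite big1 // => n _; rewrite /s /tlift big1 // => m _.
    by rewrite tcoef0 big1 // => q _; rewrite !pure0l.
  under eq_bigr => a _ do (under eq_bigr => m _ do rewrite -W).
  under eq_bigr => a _ do rewrite exchange_big.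
  rewrite exchange_big; apply: eq_bigr => n _ /=.
  by rewrite -(Yn n) ssum; apply: eq_bigr => a _; rewrite ssum.
move=> a m; rewrite -/(Y a m).
have := congr1 (fun u => tcoef (tcoef u m) a) Z; rewrite !tcoef0 exchange_big /=.
under eq_bigr => q _ do rewrite -pure_suml.
rewrite (tcoef_tlift_pure (fun q => \sum_a pure (Y a q) e`_a)).
by rewrite (tcoef_tlift_pure (fun b => Y b m)).
Qed.

(* The minimal polynomial over [K] of the element [d x] of [K ⊗ H] has        *)
(* invariant coefficients, and the counit shows that [x] is a root.           *)
Lemma algebraic_over_invariants (x : K) :
  algebraicOver (val : invariant_field K -> K) x.
Proof.
pose N := (\dim {:H}).+1; pose D n (y : A) := tcoef (d y) n.
have D0 n : D n 0 = 0 by rewrite /D coact0 tcoef0.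
pose rel (p : {poly A}) := forall n, \sum_(l < N) p`_l * D n (x ^+ l) = 0.
have [p0 [p0n p0s p0r]] : exists p : {poly A}, [/\ p != 0, (size p <= N)%N & rel p].
  (* There is one more row than there are columns, so the rows, indexed by the powers of [x] below
     [N], are linearly dependent. *)
  pose M : 'M[A]_(N, \dim {:H}) := \matrix_(l, n) D n (x ^+ l).
  have /rowV0Pn[v /sub_kermxP vM v0] : kermx M != 0.
    rewrite kermx_eq0 /row_free neq_ltn; apply/orP; left.
    exact: leq_ltn_trans (rank_leq_col M) _.
  exists (rVpoly v); split.
  - by apply: contra_neq v0 => pv0; rewrite -[v]rVpolyK pv0 linear0.
  - exact: size_poly.
  - move=> n; have /rowP/(_ n) := vM; rewrite !mxE => E; rewrite -[RHS]E.
    by apply: eq_bigr => l _; rewrite coef_rVpoly_ord !mxE.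
(* The size of a shortest nonzero relation is sought; the bound [N] is kept because [rel] sees only
   the first [N] coefficients. *)
pose Q s := `[< exists p : {poly A}, [/\ p != 0, rel p, (size p <= N)%N & size p = s] >].
have exQ : exists s, Q s by exists (size p0); apply/asboolP; exists p0.
have [s /asboolP[p1 [p1n p1r p1N p1s]] smin] := ex_minnP exQ.
have relZ c p : rel p -> rel (c *: p).
  move=> pr n; transitivity (c * \sum_(l < N) p`_l * D n (x ^+ l)).
    by rewrite mulr_sumr; apply: eq_bigr => l _; rewrite coefZ mulrA.
  by rewrite pr mulr0.
pose p := (lead_coef p1)^-1 *: p1.
have c0 : (lead_coef p1)^-1 != 0 by rewrite invr_eq0 lead_coef_eq0.
have pr : rel p by exact: relZ.
have ps : size p = s by rewrite size_scale.
have pm : p`_(s.-1) = 1 by rewrite -ps -lead_coefE lead_coefZ mulVf // lead_coef_eq0.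
have pN : (s <= N)%N by rewrite -p1s.
have s0 : (0 < s)%N by rewrite -p1s size_poly_gt0.
have pC l : p`_l \in @invariants k H K.
  apply/invariantsE => a; apply/subr0_eq; rewrite -/(D a _).
  (* By [coact_relation] the coordinates at [a] of the coefficients of [p] form a relation too.
     Subtracting the multiple of [p] expected for invariants kills the leading term, as [p] is
     monic, so minimality forces [q = 0]. *)
  pose q := \poly_(b < s) (D a p`_b - coord e a 1 *: p`_b).
  have qE b : q`_b = D a p`_b - coord e a 1 *: p`_b.
    rewrite coef_poly; case: ltnP => // sb.
    by rewrite [p`_b]nth_default ?ps // D0 scaler0 subrr.
  rewrite -qE; suff -> : q = 0 by rewrite coef0.
  apply/eqP; apply: contraT => q0.
  have qs : (size q < s)%N.
    rewrite -(prednK s0) ltnS; apply/leq_sizeP => b; rewrite leq_eqVlt.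
    case/predU1P=> [<-|]; last first.
      rewrite (prednK s0) => sb; rewrite qE [p`_b]nth_default ?ps //.
      by rewrite D0 scaler0 subrr.
    rewrite qE pm /D.
    have -> : d 1 = pure 1 1 by exact: rmorph1.
    by rewrite tcoef_pure subrr.
  have := smin (size q); rewrite leqNgt qs; apply.
  apply/asboolP; exists q; split=> //; last exact: leq_trans (ltnW qs) pN.
  move=> n; have := coact_relation pr a n.
  move=> E; transitivity (\sum_(l < N) D a p`_l * D n (x ^+ l)
      - coord e a 1 *: \sum_(l < N) p`_l * D n (x ^+ l)); last first.
    by rewrite pr scaler0 subr0; exact: E.
  rewrite scaler_sumr -sumrB; apply: eq_bigr => b _.
  by rewrite qE mulrBl scalerAl.
(* Contracting the relation with the counit turns each ∂(x^l) back into x^l. *)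
have px : root p x.
  apply/rootP; rewrite (horner_coef_wide x (n := N)) ?ps //.
  transitivity (\sum_(l < N) p`_l * \sum_(n < \dim {:H}) counit H e`_n *: D n (x ^+ l)).
    by apply: eq_bigr => l _; congr (_ * _); rewrite -[LHS]coact_counit.
  under eq_bigr do rewrite mulr_sumr.
  rewrite exchange_big big1 // => n _ /=.
  transitivity ((counit H e`_n : k) *: (\sum_(l < N) p`_l * D n (x ^+ l) : A)).
    by rewrite scaler_sumr; apply: eq_bigr => l _; rewrite scalerAr.
  by rewrite pr scaler0.
pose c l : invariant_field K := exist _ (p`_l : K) (pC l).
pose pc := \poly_(l < s) c l.
have pcE : map_poly val pc = p.
  apply/polyP => l; rewrite coef_map coef_poly; case: ltnP => // sl.
  by rewrite [RHS]nth_default ?ps.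
exists pc; last by rewrite pcE.
by rewrite -(map_poly_eq0 val) pcE -size_poly_gt0 ps.
Qed.

End Invariants.

Lemma algebraicOver_comp (F K L : fieldType) (f : {rmorphism F -> K})
    (g : {rmorphism K -> L}) w :
  (forall x, algebraicOver f x) -> algebraicOver g w -> algebraicOver (g \o f) w.
Proof.
move=> fK [p p0 pw]; apply/integral_algebraic.
apply: (@integral_root _ _ _ (map_poly g p)) => //; first by rewrite map_poly_eq0.
move=> _ /(nthP 0)[l _ <-]; rewrite coef_map; apply/integral_algebraic.
have [q q0 qx] := fK p`_l; exists q => //.
by rewrite map_poly_comp fmorph_root.
Qed.

(** * Simple extensions of a g-field *)

Section SimpleExtension.
Variables (k : fieldType) (H : hopf_algebra k) (K : gfield H).
Variables (L : fieldType) (f : {rmorphism K -> L}) (alpha : L) (m : {poly K}).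
Hypothesis gen : forall x, exists q : {poly K}, (map_poly f q).[alpha] = x.
Hypothesis mP : forall q, root (map_poly f q) alpha = (m %| q).
Hypothesis minv : forall l, m`_l \in @invariants k H K.

Local Notation A := (algebra_of (gfield_in K)).
Local Notation iL := (f \o gfield_in K : {rmorphism k -> L}).
Local Notation B := (algebra_of iL).
Local Notation e := (vbasis {:H}).

Let fB (x : A) : B := f x.

Let fBZ (c : k) (x : A) : fB (c *: x) = c *: fB x.
Proof. exact: rmorphM. Qed.

Let fBD (x y : A) : fB (x + y) = fB x + fB y.
Proof. exact: rmorphD. Qed.

Let fBM (x y : A) : fB (x * y) = fB x * fB y.
Proof. exact: rmorphM. Qed.

Let fB1 : fB 1 = 1.
Proof. exact: rmorph1. Qed.

Let fB0 : fB 0 = 0.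
Proof. exact: rmorph0. Qed.

(** The map f ⊗ id. *)
Let fT (u : tensor A H) : tensor B H := tlift (fun y h => pure (fB y) h) u.

Let tcoef_fT u n : tcoef (fT u) n = fB (tcoef u n).
Proof. by rewrite /fT /tlift (tcoef_tlift_pure (fun n => fB (tcoef u n))). Qed.

Let fT_pure (a : A) (h : H) : fT (pure a h) = pure (fB a) h.
Proof. by apply: tensorP => n; rewrite tcoef_fT !tcoef_pure fBZ. Qed.

Let fTD u v : fT (u + v) = fT u + fT v.
Proof. by apply: tensorP => n; rewrite tcoefD !tcoef_fT tcoefD fBD. Qed.

Let fT0 : fT 0 = 0.
Proof. by apply: tensorP => n; rewrite tcoef_fT !tcoef0 fB0. Qed.

Let fT_sum I r (P : pred I) (F : I -> tensor A H) :
  fT (\sum_(j <- r | P j) F j) = \sum_(j <- r | P j) fT (F j).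
Proof. exact: (big_morph fT fTD fT0). Qed.

Let fTM u v : fT (u * v) = fT u * fT v.
Proof.
rewrite [v]tensorE /tlift tensor_mul_sum [in RHS]fT_sum.
under [in RHS]eq_bigr do rewrite fT_pure.
rewrite tensor_mul_sum fT_sum; apply: eq_bigr => n _.
rewrite fT_sum; apply: eq_bigr => p _.
by rewrite fT_pure fBM tcoef_fT.
Qed.

Let psi (c : K) : tensor B H := fT (coact K c).

Let psiB : zmod_morphism psi.
Proof.
move=> x y; apply/eqP; rewrite eq_sym subr_eq /psi -fTD; apply/eqP; congr fT.
transitivity (coact K ((x - y) + y)); first by rewrite subrK.
exact: rmorphD.
Qed.

Let psiM : monoid_morphism psi.
Proof.
split=> [|x y]; last by rewrite /psi -fTM -coactM.
by rewrite /psi [coact K 1]rmorph1 [fT 1]fT_pure fB1.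
Qed.

Let psi_rmorphism : {rmorphism K -> tensor B H} :=
  HB.pack psi (GRing.isZmodMorphism.Build K (tensor B H) psi psiB)
    (GRing.isMonoidMorphism.Build K (tensor B H) psi psiM).

Let tcoef_pure1_mul (u : tensor B H) b n : tcoef (pure b 1 * u) n = b * tcoef u n.
Proof.
rewrite [u in LHS]tensorE /tlift mulr_sumr.
under eq_bigr do rewrite pureM mul1r.
by rewrite (tcoef_tlift_pure (fun l => b * tcoef u l)).
Qed.

Let psi_comm : commr_rmorph psi_rmorphism (pure (alpha : B) 1).
Proof.
move=> c; apply: tensorP => n.
by rewrite tcoef_pure1_mul tcoef_mul_pure1 mulrC.
Qed.

(** The ring morphism from K[X] to L ⊗ H that is (f ⊗ id) ∘ ∂ on K and sends X to alpha ⊗ 1. *)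
Let Delta (q : {poly K}) : tensor B H := horner_morph psi_comm q.

Let pureX (b : B) l : pure b (1 : H) ^+ l = pure (b ^+ l) 1 :> tensor B H.
Proof.
elim: l => [|l IH]; first by rewrite !expr0.
by rewrite !exprS IH pureM mulr1.
Qed.

Let DeltaE q : Delta q = \sum_(l < size q) psi q`_l * pure ((alpha : B) ^+ l) 1.
Proof.
rewrite /Delta /horner_morph (horner_coef_wide _ (size_poly _ _)).
by apply: eq_bigr => l _; rewrite pureX coef_map.
Qed.

(** As the coefficients of [m] are invariant, [Delta m] is m(alpha) ⊗ 1 = 0; so [Delta] factors
    through K[X]/(m) = L. *)
Let Delta_root q : (map_poly f q).[alpha] = 0 -> Delta q = 0.
Proof.
move=> /rootP; rewrite mP => /dvdpP[u ->].
have -> : Delta (u * m) = Delta u * Delta m by exact: rmorphM.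
have malpha : (map_poly f m).[alpha] = 0 by apply/rootP; rewrite mP.
rewrite [Delta m]DeltaE.
have -> : \sum_(l < size m) psi m`_l * pure ((alpha : B) ^+ l) 1
    = pure ((map_poly f m).[alpha] : B) 1.
  rewrite (horner_coef_wide _ (size_poly _ _)) pure_suml; apply: eq_bigr => l _.
  rewrite coef_map /psi; have /eqP -> := minv l.
  by rewrite fT_pure pureM mulr1.
by rewrite malpha pure0l mulr0.
Qed.

Let ev (q : {poly K}) : B := (map_poly f q).[alpha].

Let repr (x : B) : {poly K} := sval (cid (gen x)).

Let ev_repr x : ev (repr x) = x.
Proof. exact: (svalP (cid (gen x))). Qed.

(** Defined on a chosen representative; [coactL_ev] shows that the choice does not matter. *)
Let coactL (x : B) : tensor B H := Delta (repr x).

Let evB p q : ev (p - q) = ev p - ev q.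
Proof. by rewrite /ev rmorphB hornerD hornerN. Qed.

Let evM p q : ev (p * q) = ev p * ev q.
Proof. by rewrite /ev rmorphM hornerM. Qed.

Let coactL_ev q : coactL (ev q) = Delta q.
Proof.
apply/eqP; rewrite -subr_eq0 /coactL /Delta -rmorphB; apply/eqP/Delta_root.
by rewrite -[LHS]/(ev _) evB ev_repr subrr.
Qed.

Let coactLB : zmod_morphism coactL.
Proof.
move=> x y; rewrite -[x]ev_repr -[y]ev_repr -evB !coactL_ev.
exact: rmorphB.
Qed.

Let coactLM : monoid_morphism coactL.
Proof.
split=> [|x y].
  have -> : 1 = ev 1 by rewrite /ev rmorph1 hornerC.
  by rewrite coactL_ev /Delta rmorph1.
rewrite -[x]ev_repr -[y]ev_repr -evM !coactL_ev.
exact: rmorphM.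
Qed.

Let coactL_fB (c : A) : coactL (fB c) = fT (coact K c).
Proof.
have -> : fB c = ev (c : K)%:P by rewrite /ev map_polyC hornerC.
by rewrite coactL_ev /Delta horner_morphC.
Qed.

Let coactLZ : scalable coactL.
Proof.
move=> c x; have -> : c *: x = fB (c *: 1) * x.
  by rewrite fBZ fB1 -scalerAl mul1r.
rewrite coactLM.2 coactL_fB linearZ /= [coact K 1]rmorph1.
have -> : fT (c *: 1) = c *: 1.
  by apply: tensorP => n; rewrite tcoefZ tcoef_fT tcoefZ fBZ !tcoef_pure -fB1 fBZ.
by rewrite -scalerAl mul1r.
Qed.

Let coactL_lrmorphism : {lrmorphism B -> tensor B H} :=
  HB.pack coactL (GRing.isZmodMorphism.Build B (tensor B H) coactL coactLB)
    (GRing.isMonoidMorphism.Build B (tensor B H) coactL coactLM)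
    (GRing.isScalable.Build k B (tensor B H) *:%R coactL coactLZ).

(** The comodule axioms are additive, so they can be tested on monomials, where the factor alpha^l
    behaves as an invariant. *)
Let monomial_ind (Q : B -> Prop) : Q 0 -> (forall x y, Q x -> Q y -> Q (x + y)) ->
  (forall c l, Q (fB c * (alpha : B) ^+ l)) -> forall x, Q x.
Proof.
move=> Q0 QD Qm x; rewrite -[x]ev_repr /ev (horner_coef_wide _ (size_poly _ _)).
by apply: (big_ind Q) => // l _; rewrite coef_map; exact: Qm.
Qed.

Let coactL_monomial (c : A) l :
  coactL (fB c * (alpha : B) ^+ l) = fT (coact K c) * pure ((alpha : B) ^+ l) 1.
Proof.
rewrite coactLM.2 coactL_fB; congr (_ * _).
have aE : (alpha : B) ^+ l = ev 'X^l by rewrite /ev map_polyXn hornerXn.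
rewrite [in LHS]aE coactL_ev -pureX -(horner_morphX psi_comm).
exact: rmorphXn.
Qed.

Let coactL_counit (x : B) : tlift (fun y h => counit H h *: y) (coactL x) = x.
Proof.
move: x; apply: monomial_ind => [|x y Ex Ey|c l].
- rewrite /tlift big1 // => n _.
  by rewrite [coactL 0](rmorph0 coactL_lrmorphism) tcoef0 scaler0.
- rewrite -[in RHS]Ex -[in RHS]Ey /tlift -big_split; apply: eq_bigr => n _ /=.
  by rewrite [coactL (x + y)](rmorphD coactL_lrmorphism) tcoefD scalerDr.
rewrite coactL_monomial /tlift -[in RHS](coact_counit c) /tlift.
rewrite [in RHS](big_morph fB fBD fB0) [RHS]mulr_suml; apply: eq_bigr => n _.
rewrite tcoef_mul_pure1 tcoef_fT fBZ; exact: scalerAl.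
Qed.

Let coactL_coassoc (x : B) :
  tlift (fun y h => tlift (fun h1 h2 => pure (pure y h1) h2) (comul H h)) (coactL x)
    = tlift (fun y h => pure (coactL y) h) (coactL x).
Proof.
apply/coassocE => n; move: x; apply: monomial_ind => [|x y Ex Ey|c l].
- rewrite [coactL 0](rmorph0 coactL_lrmorphism) tcoef0.
  rewrite [coactL 0](rmorph0 coactL_lrmorphism).
  by rewrite big1 // => p _; rewrite tcoef0 pure0l.
- rewrite [coactL (x + y)](rmorphD coactL_lrmorphism) tcoefD.
  rewrite [coactL (_ + _)](rmorphD coactL_lrmorphism) [X in X + _]Ex [X in _ + X]Ey.
  by rewrite -big_split; apply: eq_bigr => p _; rewrite tcoefD pureDl.
rewrite coactL_monomial tcoef_mul_pure1 tcoef_fT coactL_monomial coact_tcoef.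
rewrite fT_sum mulr_suml; apply: eq_bigr => p _.
by rewrite fT_pure pureM mulr1 tcoef_mul_pure1 tcoef_fT.
Qed.

Let extension : gfield H :=
  @GField k H L iL coactL_lrmorphism coactL_counit coactL_coassoc.

Lemma gclosed_simple_extension : gclosed K -> (forall y, algebraicOver f y) ->
  exists c, f c = alpha.
Proof.
move=> Kclosed falg; by apply: (Kclosed extension f).
Qed.

End SimpleExtension.

Lemma gclosed_root (k : fieldType) (H : hopf_algebra k) (K : gfield H)
    (Omega : closedFieldType) (j : {rmorphism K -> Omega}) (w : Omega)
    (m0 : {poly invariant_field K}) (m := map_poly val m0) :
    (forall w, algebraicOver j w) -> gclosed K ->
    m \is monic -> irreducible_poly m ->
    (forall q, root (map_poly j q) w = (m %| q)) ->
  range (invariant_in j) w.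
Proof.
move=> jalg Kclosed mm irr mP.
(* K(w) is realised as a field [D] embedded in [Omega] by [a]; [f] below is the inclusion of K in
   it. *)
have [D [a [b GE]]] :=
  field_graph_ex (adjoin_is_field_graph (b := j) (jalg w) (fun _ => id)).
have inD u v : adjoin_graph j j w w (u, v) -> exists d, a d = u.
  by rewrite GE => -[d _ [<- _]]; exists d.
have [|f fP] := @rmorphism_lift _ _ _ j a.
  move=> _ [c _ <-]; have [d <-] := inD _ _ (adjoin_graph_base j j w w c).
  by exists d.
have [alpha alphaE] := inD _ _ (adjoin_graph_gen j j w w).
have afE q : map_poly a (map_poly f q) = map_poly j q.
  by rewrite -map_poly_comp (eq_map_poly fP).
have [|||||c cE] := @gclosed_simple_extension _ _ K D f alpha m.
- move=> x; have : graph a b (a x, b x) by exists x.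
  rewrite -GE => -[q _ [qx _]]; exists q.
  by apply: (fmorph_inj a); rewrite -qx -horner_map afE alphaE.
- by move=> q; rewrite -(fmorph_root a) afE alphaE mP.
- by move=> l; rewrite coef_map; exact: valP.
- exact: Kclosed.
- by move=> y; have [p p0 py] := jalg (a y); exists p; rewrite // -(fmorph_root a) afE.
have jc : j c = w by rewrite -fP cE.
(* Since [w] comes from K, the irreducible [m] is linear; its constant term is invariant, hence so
   is [c]. *)
have mc : m = 'X - c%:P.
  apply/eqP; rewrite -eqp_monic ?monicXsubC //.
  have [_] := irredp_XsubC c; apply; first by rewrite neq_ltn irr.1 orbT.
  by rewrite -mP rmorphB /= map_polyX map_polyC root_XsubC; apply/eqP; rewrite -jc.
have c0 : val (- m0`_0) = c.
  have := congr1 (fun p : {poly K} => p`_0) mc.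
  rewrite coef_map coefB coefX coefC /= sub0r => E.
  transitivity (- val m0`_0); last by rewrite [val _]E opprK.
  exact: (rmorphN (val : {rmorphism invariant_field K -> K})).
by exists (- m0`_0) => //=; rewrite [X in j X]c0.
Qed.

Theorem theorem4p9 (k : fieldType) (H : hopf_algebra k) (K : gfield H)
    (Omega : closedFieldType) (j : {rmorphism K -> Omega})
    (Omega_alg : forall w : Omega, algebraicOver j w)
    (K_gclosed : gclosed K) :
  exists r : absGal (invariant_in j) -> normal_Gal (invariant_in j) j,
    unique (@is_restriction _ _ (invariant_in j) _ j) r /\ frattini_cover r.
Proof.
pose iota : {rmorphism invariant_field K -> K} := val.
have ialg w : algebraicOver (j \o iota) w.
  exact: algebraicOver_comp (@algebraic_over_invariants _ _ K) (Omega_alg w).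
have [r rP] := restriction_ex ialg; exists r; split.
  by split=> // r' r'P; exact: (restriction_unique ialg rP r'P).
split=> [|N Ngrp Ncl Nonto]; first exact: (restriction_epi ialg rP).
(* It remains to see that every [x] fixed by [N] lies in C. *)
apply: closed_subgroup_full => // [x|x xN t].
  exact: (Gal_over_orbit ialg (@separable_base _ _ (j \o iota))).
have [m [mm irr mP]] := minpoly_ex (Omega_alg (val x)).
have [m0 mE] := frattini_minpoly ialg rP Nonto xN mm mP.
rewrite mE in mm irr mP.
have xC := gclosed_root Omega_alg K_gclosed mm irr mP.
exact: gal_fix.
Qed.
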